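(* Let $H\in\mathbb{C}^{M\times N}$, $M\ge N$, let $E_s,N_0>0$ and $1\le\nu\le N-1$. Let $C^{AWGN}=\ln\det\!\big(\tfrac{E_s}{N_0}H^\dagger H+I_N\big)$, and let $I_{LB}^{AWLD}$ be the achievable-information-rate lower bound of the AWLD detector of puncturing order $\nu$ (defined in the context). Then the gap to capacity is $$C^{AWGN}-I_{LB}^{AWLD}=\sum_{k=1}^{N-\nu}\ln\!\Big(s_{a\,kk}^2\,\big\|[S_a^{-1}]_{\bar k}\big\|^2+1\Big),$$ where $s_{a\,kk}$ is the $k$-th diagonal element of the matrix $S_a$ defined in the context, and $[S_a^{-1}]_{\bar k}$ is the row vector consisting of the first $k-1$ elements of row $k$ of $S_a^{-1}$, excluding the diagonal element (empty, with norm $0$, for $k=1$).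
   Context: $(\cdot)^\dagger$ is the conjugate transpose; $\|\cdot\|$ is the Euclidean norm; $\mathcal{CN}$ is the circularly-symmetric complex Gaussian distribution. $\mathrm{diag}(A)$ denotes the diagonal matrix with the same diagonal entries as $A$. Let $H_a=\begin{bmatrix}\frac1{\sqrt{N_0}}H\\ \frac1{\sqrt{E_s}}I_N\end{bmatrix}$, and let $H_a=Q_aL_a$ be its thin QL decomposition: $Q_a$ is $(M+N)\times N$ with $Q_a^\dagger Q_a=I_N$, and $L_a$ is $N\times N$ lower triangular with real positive diagonal entries. Partition $L_a=\begin{bmatrix}P_a&0\\R_a&S_a\end{bmatrix}$ with $P_a$ of size $\nu\times\nu$ and $S_a$ of size $(N-\nu)\times(N-\nu)$. Put $\Omega_a=\mathrm{diag}(S_a^{-1}S_a^{-\dagger})^{-1/2}$ and $L_{ap}=\begin{bmatrix}P_a&0\\ \Omega_aS_a^{-1}R_a&\Omega_a\end{bmatrix}$. AWLD rate bound: let $y=Hx+n$ with $x\sim\mathcal{CN}(0,E_sI_N)$, $n\sim\mathcal{CN}(0,N_0I_M)$ independent, $p(x)$ the density of $x$, $\mathbf{M}=H^\dagger(HH^\dagger+\frac{N_0}{E_s}I_M)^{-1}$, $G_{ap}=L_{ap}^\dagger L_{ap}$, $F_{ap}=\mathbf{M}^\dagger G_{ap}$, $p_{ap}(y|x)=\exp(2\,\mathrm{Re}\{y^\dagger F_{ap}x\}-x^\dagger G_{ap}x+\frac1{E_s}x^\dagger x)$ and $p_{ap}(y)=\int_{\mathbb{C}^N}p_{ap}(y|x)p(x)\,dx$.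 Then $I_{LB}^{AWLD}=\mathsf{E}_{Y,X}[\ln p_{ap}(y|x)]-\mathsf{E}_Y[\ln p_{ap}(y)]$, which is equal to $N\ln E_s+\ln\det(L_{ap}^\dagger L_{ap})$. *)

(* Defs.v *)
(* MathComp and MathComp-Analysis, with complex numbers R[i] over R : realType.
   [A ^t*] is the conjugate transpose (spectral.v). *)
From HB Require Import structures.
From mathcomp Require Import all_boot all_order all_algebra.
From mathcomp Require Import all_classical all_reals all_analysis.
From mathcomp Require Import complex.

Set Implicit Arguments.
Unset Strict Implicit.
Unset Printing Implicit Defensive.

Import Order.TTheory GRing.Theory Num.Theory.
Import numFieldNormedType.Exports.

Local Open Scope classical_set_scope.
Local Open Scope ring_scope.
Local Open Scope complex_scope.
Local Open Scope sesquilinear_scope.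

Section SigmaFiniteProduct.
Context d1 d2 (T1 : measurableType d1) (T2 : measurableType d2) (R : realType).
Variables (mu : {sigma_finite_measure set T1 -> \bar R})
  (nu : {sigma_finite_measure set T2 -> \bar R}).

(* The library's product measure under a new name: instance resolution on
   [mu \x nu] itself looks for subprobabilities and does not find the
   sigma-finite structure. *)
Definition sfprod : set (T1 * T2) -> \bar R := (mu \x nu)%E.

HB.instance Definition _ := Measure.on sfprod.

Let sfprod_sigma_finite : sigma_finite setT sfprod.
Proof.
have /sigma_finiteP[F [TF ndF Foo]] := sigma_finiteT mu.
have /sigma_finiteP[G [TG ndG Goo]] := sigma_finiteT nu.
exists (fun k => F k `*` G k).
  rewrite -setXTT TF TG predeqE => -[x y]; split.
    move=> [/= [k _ Fkx] [l _ Gly]]; exists (maxn k l) => //; split.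
    - by move: x Fkx; exact/subsetPset/ndF/leq_maxl.
    - by move: y Gly; exact/subsetPset/ndG/leq_maxr.
  by move=> [k _ []/= ? ?]; split; exists k.
move=> k; have [mF Fk] := Foo k; have [mG Gk] := Goo k.
split; first exact: measurableX.
by rewrite /sfprod product_measure1E// lte_mul_pinfty// ge0_fin_numE.
Qed.

HB.instance Definition _ := Measure_isSigmaFinite.Build _ _ _ sfprod
  sfprod_sigma_finite.

End SigmaFiniteProduct.

Section TupleMeasure.
Context d (T : measurableType d) (R : realType).

Definition tcons n (p : T * n.-tuple T) : n.+1.-tuple T := [tuple of p.1 :: p.2].

Lemma measurable_tcons n : measurable_fun setT (@tcons n).
Proof. exact: measurable_cons. Qed.

Lemma preimage_tcons_measurable n (A : set (n.+1.-tuple T)) :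
  measurable A -> measurable (@tcons n @^-1` A).
Proof.
by move=> mA; rewrite -[X in measurable X]setTI; exact: measurable_tcons.
Qed.

Section Step.
Variables (mu : {sigma_finite_measure set T -> \bar R}) (n : nat).
Variable nu : {sigma_finite_measure set (n.-tuple T) -> \bar R}.

Definition cons_measure : set (n.+1.-tuple T) -> \bar R :=
  pushforward (sfprod mu nu) (@tcons n).

Let cons_measure0 : cons_measure set0 = 0%E.
Proof. by rewrite /cons_measure /pushforward preimage_set0 measure0. Qed.

Let cons_measure_ge0 A : (0 <= cons_measure A)%E.
Proof. by rewrite /cons_measure /pushforward; apply: measure_ge0. Qed.

Let cons_measure_sigma_additive : semi_sigma_additive cons_measure.
Proof.
move=> F mF tF mUF; rewrite /cons_measure /pushforward preimage_bigcup.
apply: measure_semi_sigma_additive.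
- by move=> k; exact: preimage_tcons_measurable.
- apply/trivIsetP => /= i j _ _ ij; rewrite -preimage_setI.
  by move/trivIsetP : tF => /(_ _ _ _ _ ij) ->//; rewrite preimage_set0.
- by rewrite -preimage_bigcup; exact: preimage_tcons_measurable.
Qed.

HB.instance Definition _ := isMeasure.Build _ _ _ cons_measure
  cons_measure0 cons_measure_ge0 cons_measure_sigma_additive.

Let cons_measure_sigma_finite : sigma_finite setT cons_measure.
Proof.
have [E TE Eoo] := sigma_finiteT (sfprod mu nu).
pose split (t : n.+1.-tuple T) : T * n.-tuple T := (thead t, [tuple of behead t]).
have msplit : measurable_fun setT split.
  apply/measurable_fun_pairP; split; last exact: measurable_behead.
  exact: measurable_tnth.
have tconsK : cancel (@tcons n) split.
  by case=> x t; congr pair; apply/val_inj.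
exists (fun k => split @^-1` E k).
  by rewrite -preimage_bigcup -TE preimage_setT.
move=> k; have [mE Ek] := Eoo k; split.
  by rewrite -[X in measurable X]setTI; exact: msplit.
rewrite /cons_measure /pushforward -comp_preimage.
rewrite (_ : (split \o @tcons n) @^-1` E k = E k)//.
by apply/funext => p; rewrite -[in RHS](tconsK p).
Qed.

HB.instance Definition _ := Measure_isSigmaFinite.Build _ _ _ cons_measure
  cons_measure_sigma_finite.

End Step.

(* n-fold product measure; T^0 is a point and carries the Dirac mass. *)
Fixpoint tuple_measure (mu : {sigma_finite_measure set T -> \bar R}) (n : nat) :
    {sigma_finite_measure set (n.-tuple T) -> \bar R} :=
  if n is m.+1 then cons_measure mu (tuple_measure mu m)
  else \d_([tuple] : 0.-tuple T).

End TupleMeasure.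

Section ComplexGaussian.
Variable R : realType.

(* C is measured through its real and imaginary parts, as R * R; a vector of C^n
   is an n-tuple of such pairs, read as a column of R[i] by [cvec]. *)
Definition Cspace := (measurableTypeR R * measurableTypeR R)%type.

Definition lebesgueC n : {sigma_finite_measure set (n.-tuple Cspace) -> \bar R} :=
  tuple_measure (sfprod (@lebesgue_measure R) (@lebesgue_measure R)) n.

Definition cvec n (t : n.-tuple Cspace) : 'cV[R[i]]_n :=
  \col_i ((tnth t i).1 +i* (tnth t i).2).

(* The single entry of a 1 x 1 matrix, as in u^t* *m v. *)
Definition scal (A : 'M[R[i]]_1) : R[i] := A 0 0.

(* Density of CN(0, s I_n) at x: exp(- x^t* x / s) / (pi s)^n. *)
Definition cn_pdf (s : R) n (x : 'cV[R[i]]_n) : R :=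
  expR (- complex.Re (scal (x^t* *m x)) / s) / (pi * s) ^+ n.

Definition is_CN d (T : measurableType d) (P : probability T R) (s : R) n
    (X : {RV P >-> n.-tuple Cspace}) : Prop :=
  forall A, measurable A ->
    distribution P X A = (\int[lebesgueC n]_(t in A) (cn_pdf s (cvec t))%:E)%E.

Definition independent_RV2 d d1 d2 (T : measurableType d)
    (T1 : measurableType d1) (T2 : measurableType d2) (P : probability T R)
    (X : {RV P >-> T1}) (Y : {RV P >-> T2}) : Prop :=
  forall A B, measurable A -> measurable B ->
    P ((X @^-1` A) `&` (Y @^-1` B)) = (P (X @^-1` A) * P (Y @^-1` B))%E.

End ComplexGaussian.

Section AWLD.
Variable R : realType.
Local Notation C := R[i].

Definition enorm n (v : 'rV[C]_n) : R :=
  Num.sqrt (\sum_j (complex.Re (v 0 j) ^+ 2 + complex.Im (v 0 j) ^+ 2)).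

Definition Haug M N (Es N0 : R) (H : 'M[C]_(M, N)) : 'M[C]_(M + N, N) :=
  col_mx ((Num.sqrt N0)^-1%:C *: H) ((Num.sqrt Es)^-1%:C *: 1%:M).

(* A = Q L with Q^t* Q = I and L lower triangular ([is_trig_mx]); 0 < L i i in
   R[i] says that L i i is real and positive. *)
Definition is_thin_QL m n (A : 'M[C]_(m, n)) (Q : 'M[C]_(m, n)) (L : 'M[C]_n) :
    Prop :=
  [/\ A = Q *m L, Q^t* *m Q = 1%:M, is_trig_mx L & forall i, 0 < L i i].

(* L cut after its first nu rows and columns. *)
Definition partition_at N nu (h : (nu <= N)%N) (L : 'M[C]_N) :
    'M[C]_(nu + (N - nu)) :=
  castmx (esym (subnKC h), esym (subnKC h)) L.

Definition Pblock N nu (h : (nu <= N)%N) (L : 'M[C]_N) : 'M[C]_nu :=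
  ulsubmx (partition_at h L).

Definition Rblock N nu (h : (nu <= N)%N) (L : 'M[C]_N) : 'M[C]_(N - nu, nu) :=
  dlsubmx (partition_at h L).

Definition Sblock N nu (h : (nu <= N)%N) (L : 'M[C]_N) : 'M[C]_(N - nu) :=
  drsubmx (partition_at h L).

(* diag(S^-1 S^-t* )^(-1/2) *)
Definition Omega r (S : 'M[C]_r) : 'M[C]_r :=
  diag_mx (\row_k (sqrtC ((invmx S *m (invmx S)^t*) k k))^-1).

(* The punctured factor [P 0; Omega S^-1 R, Omega]. *)
Definition Lpunct N nu (h : (nu <= N)%N) (L : 'M[C]_N) : 'M[C]_N :=
  let S := Sblock h L in
  castmx (subnKC h, subnKC h)
    (block_mx (Pblock h L) 0 (Omega S *m invmx S *m Rblock h L) (Omega S)).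

Definition mmse M N (Es N0 : R) (H : 'M[C]_(M, N)) : 'M[C]_(N, M) :=
  H^t* *m invmx (H *m H^t* + (N0 / Es)%:C%:M).

Definition Gap N (Lap : 'M[C]_N) : 'M[C]_N := Lap^t* *m Lap.

Definition Fap M N (Es N0 : R) (H : 'M[C]_(M, N)) (Lap : 'M[C]_N) :
    'M[C]_(M, N) :=
  (mmse Es N0 H)^t* *m Gap Lap.

(* The mismatched metric p_ap(y|x) for the punctured factor Lap. *)
Definition p_cond M N (Es N0 : R) (H : 'M[C]_(M, N)) (Lap : 'M[C]_N)
    (y : 'cV[C]_M) (x : 'cV[C]_N) : R :=
  expR (2 * complex.Re (scal (y^t* *m Fap Es N0 H Lap *m x))
        - complex.Re (scal (x^t* *m Gap Lap *m x)) + Es^-1 * complex.Re (scal (x^t* *m x))).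

Definition p_out M N (Es N0 : R) (H : 'M[C]_(M, N)) (Lap : 'M[C]_N)
    (y : 'cV[C]_M) : \bar R :=
  (\int[@lebesgueC R N]_t
     (p_cond Es N0 H Lap y (cvec t) * cn_pdf Es (cvec t))%:E)%E.

(* E_{Y,X}[ln p_ap(y|x)] - E_Y[ln p_ap(y)] with y = H x + w; the second
   expectation is spelt as an integral because p_ap(y) lives in \bar R. *)
Definition I_LB M N (Es N0 : R) (H : 'M[C]_(M, N)) (Lap : 'M[C]_N)
    d (T : measurableType d) (P : probability T R)
    (X : {RV P >-> N.-tuple (Cspace R)}) (W : {RV P >-> M.-tuple (Cspace R)}) :
    \bar R :=
  let y w := H *m cvec (X w) + cvec (W w) in
  ('E_P[(fun w => ln (p_cond Es N0 H Lap (y w) (cvec (X w))))%R]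
   - \int[P]_w lne (p_out Es N0 H Lap (y w)))%E.

Definition C_AWGN M N (Es N0 : R) (H : 'M[C]_(M, N)) : R :=
  ln (complex.Re (\det ((Es / N0)%:C *: (H^t* *m H) + 1%:M))).

(* Entries of row k of A strictly before the diagonal. *)
Definition row_before r (A : 'M[C]_r) (k : 'I_r) : 'rV[C]_k :=
  \row_(j < k) A k (widen_ord (ltnW (ltn_ord k)) j).

End AWLD.

(* Main.v *)
(** With [y = H x + n] and [m] the MMSE estimate of [x], completing the square
    gives [p_ap(y) = exp |L_ap m|^2 / (E_s^N det (L_ap^t* L_ap))]; the Gaussian
    integral is computed one coordinate at a time because [L_ap] is triangular.
    Both expectations are then means of quadratic forms in [(x, n)].  The
    quadratic terms cancel up to the trace of [Q Q^t*], where [L_ap = Q L_a] with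
    [Q = diag(1, Omega S^-1)]; the normalisation by [Omega] makes this trace [N],
    so that [I_LB = ln (E_s^N det (L_ap^t* L_ap))].  As
    [C = ln (E_s^N det (L_a^t* L_a))], the gap is the logarithm of
    [prod_k (s_kk / Omega_kk)^2].

    The covariance of a circular Gaussian vector is read off its exponential
    moments: [u^2 + 2 <= exp u + exp (-u)] bounds the second moment of every real
    linear form from above, [1 - u <= exp (-u)] bounds the trace of the covariance
    from below, and the two bounds meet. *)
From HB Require Import structures.
Require Import Defs.
From mathcomp Require Import all_boot all_order all_algebra.
From mathcomp Require Import all_classical all_reals all_analysis.
From mathcomp Require Import measurable_realfun.
From mathcomp Require Import complex ring lra.

Set Implicit Arguments.
Unset Strict Implicit.
Unset Printing Implicit Defensive.

Import Order.TTheory GRing.Theory Num.Theory.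
Import numFieldNormedType.Exports.

Local Open Scope classical_set_scope.
Local Open Scope ring_scope.
Local Open Scope complex_scope.
Local Open Scope sesquilinear_scope.

(** * Integration against a measure given by a density *)

Section IntegralTools.
Context d (T : measurableType d) (R : realType).

Import HBNNSimple.

(** Monotone convergence along increasing simple functions on both sides reduces the claim to one
    simple function, where the density formula for [nu] is applied to each level set. *)
Lemma ge0_integral_density (mu nu : {measure set T -> \bar R}) (g : T -> R)
    (f : T -> \bar R) :
  measurable_fun setT g -> (forall x, 0 <= g x) ->
  (forall A, measurable A -> nu A = \int[mu]_(x in A) (g x)%:E)%E ->
  measurable_fun setT f -> (forall x, 0 <= f x)%E ->
  (\int[nu]_x f x = \int[mu]_x (f x * (g x)%:E))%E.
Proof.
move=> mg g0 nuE mf f0.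
have mEg : measurable_fun setT (EFin \o g) by exact/measurable_EFinP.
pose f_ := nnsfun_approx measurableT mf.
have limf x : (EFin \o f_^~ x) @ \oo --> f x by exact: cvg_nnsfun_approx.
have ndf x m n : (m <= n)%N -> ((f_ m x)%:E <= (f_ n x)%:E)%E.
  by move=> mn; rewrite lee_fin; exact/lefP/nd_nnsfun_approx.
transitivity (limn (fun n => \int[nu]_x (f_ n x)%:E)%E).
  rewrite -monotone_convergence//.
  - by apply: eq_integral => x _; apply/esym/cvg_lim => //; exact: limf.
  - by move=> n; exact/measurable_EFinP/measurable_funP.
  - by move=> n x _; rewrite lee_fin.
  - by move=> x _ m n; exact: ndf.
rewrite [X in limn X](_ : _ = (fun n => \int[mu]_x ((f_ n x)%:E * (g x)%:E))%E).
  rewrite -monotone_convergence//; last 3 first.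
  - move=> n; apply: emeasurable_funM => //.
    exact/measurable_EFinP/measurable_funP.
  - by move=> n x _; rewrite mule_ge0// lee_fin.
  - by move=> x _ m n mn; rewrite lee_wpmul2r ?lee_fin// -lee_fin ndf.
  apply: eq_integral => x _; apply/cvg_lim => //.
  by apply: cvgeZr => //; exact: limf.
apply/funext => n.
have mk k : measurable (f_ n @^-1` [set k]) by [].
transitivity (\sum_(k \in range (f_ n)) k%:E * nu (f_ n @^-1` [set k]))%E.
  by rewrite integralT_nnsfun sintegralE.
under [RHS]eq_integral => x _.
  rewrite fimfunE -fsumEFin// ge0_mule_fsuml; last first.
    by move=> k; rewrite nnfun_muleindic_ge0.
  over.
rewrite ge0_integral_fsum//; last 2 first.
- move=> k; apply: emeasurable_funM => //; exact/measurable_EFinP/measurable_funM.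
- by move=> k x _; rewrite mule_ge0 ?lee_fin// -lee_fin EFinM nnfun_muleindic_ge0.
apply: eq_fsbigr => k; rewrite inE => -[x _ <-].
rewrite nuE// integral_mkcond -ge0_integralZl//; last 3 first.
- by apply/(measurable_restrictT _ _).1 => //; exact: measurable_funTS.
- by move=> y _; rewrite erestrict_ge0// => z _; rewrite lee_fin.
- by rewrite lee_fin.
apply: eq_integral => y _.
rewrite patchE indicE; case: ifPn => _; first by rewrite mulr1.
by rewrite mulr0 mule0 mul0e.
Qed.

End IntegralTools.

(** * Iterated integrals over tuples *)

Section TupleIntegral.
Context d (T : measurableType d) (R : realType).
Variable mu : {sigma_finite_measure set T -> \bar R}.

Lemma integral_tuple_measure0 (f : 0.-tuple T -> \bar R) :
  measurable_fun setT f ->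
  (\int[tuple_measure mu 0]_t f t = f [tuple])%E.
Proof. by move=> mf; rewrite integral_dirac// diracT mul1e. Qed.

(** Change of variables along [tcons], then Tonelli. This is the induction step for Gaussian
    integrals over C^n. *)
Lemma integral_tuple_measureS n (f : n.+1.-tuple T -> \bar R) :
  measurable_fun setT f -> (forall t, 0 <= f t)%E ->
  (\int[tuple_measure mu n.+1]_t f t =
   \int[mu]_x \int[tuple_measure mu n]_t f (tcons (x, t)))%E.
Proof.
move=> mf f0.
rewrite [LHS](@ge0_integral_pushforward _ _ _ _ _ _ (@measurable_tcons _ _ _))//=.
rewrite /sfprod preimage_setT (fubini_tonelli1 (f \o @tcons _ T n))//.
  by apply: measurableT_comp => //; exact: measurable_tcons.
by move=> x; exact: f0.

Qed.

End TupleIntegral.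

(** * Gaussian integrals over R and C, and squared moduli *)

Section Gaussian.
Variable R : realType.

Lemma integral_gauss_affine (l a : R) : 0 < l ->
  (\int[@lebesgue_measure R]_t (expR (- (l * t - a) ^+ 2))%:E =
   (Num.sqrt pi / l)%:E)%E.
Proof.
move=> l0.
have l0' : l != 0 by rewrite gt_eqF.
(* The standard deviation with [2 s^2 = l^-2]: the integrand is then the unnormalised normal density
   of mean [a / l], whose total mass is known. *)
pose s := l^-1 / Num.sqrt 2.
have s0 : s != 0 by rewrite mulf_neq0 ?invr_eq0 ?sqrtr_eq0 -?ltNge.
have s2 : s ^+ 2 *+ 2 = l^-2.
  by rewrite /s exprMn !exprVn sqr_sqrtr// -mulr_natr -mulrA mulVf ?mulr1.
have pk : normal_peak s = (Num.sqrt pi / l)^-1.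
  rewrite /normal_peak -mulrnAl s2 sqrtrM ?invr_ge0 ?exprn_ge0 ?(ltW l0)//.
  by rewrite -exprVn sqrtr_sqr ger0_norm ?invr_ge0 ?(ltW l0)// mulrC.
have fE x : normal_fun (a / l) s x = expR (- (l * x - a) ^+ 2).
  by rewrite /normal_fun s2 invrK; congr expR; field.
have := integral_normal_pdf (a / l) s.
rewrite /normal_pdf (negbTE s0).
under eq_integral do rewrite EFinM.
rewrite ge0_integralZl//=; last 3 first.
- by apply/measurable_EFinP; exact: measurable_normal_fun.
- by move=> x _; rewrite lee_fin normal_fun_ge0.
- by rewrite lee_fin normal_peak_ge0.
under eq_integral do rewrite fE.
rewrite pk => h.
have k0 : Num.sqrt pi / l != 0 :> R.
  by rewrite mulf_neq0 ?invr_eq0// gt_eqF// sqrtr_gt0 pi_gt0.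
by rewrite -[LHS]mul1e -(divff k0) EFinM -muleA h mule1.
Qed.

Lemma measurable_gauss_affineC (l : R) (c : R[i]) :
  measurable_fun setT (fun z : measurableTypeR R * measurableTypeR R =>
    (expR (- ((l * z.1 - complex.Re c) ^+ 2 +
              (l * z.2 - complex.Im c) ^+ 2)))%:E).
Proof.
have mg (f : measurableTypeR R * measurableTypeR R -> R) (a : R) :
    measurable_fun setT f -> measurable_fun setT (fun t => (l * f t - a) ^+ 2).
  move=> mf; apply: measurable_funX; apply: measurable_funB => //.
  exact: measurable_funM.
apply/measurable_EFinP; apply: measurableT_comp => //.
by apply: measurableT_comp => //; apply: measurable_funD; apply: mg.
Qed.

Lemma integral_gauss_affineC (l : R) (c : R[i]) : 0 < l ->
  (\int[sfprod (@lebesgue_measure R) (@lebesgue_measure R)]_z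
     (expR (- ((l * z.1 - complex.Re c) ^+ 2 + (l * z.2 - complex.Im c) ^+ 2)))%:E =
   (pi / l ^+ 2)%:E)%E.
Proof.
move=> l0; rewrite /sfprod.
have mE (a : R) : measurable_fun setT
    (fun t : measurableTypeR R => (expR (- (l * t - a) ^+ 2))%:E).
  apply/measurable_EFinP; apply: measurableT_comp => //.
  apply: measurableT_comp => //; apply: measurable_funX.
  by apply: measurable_funB => //; exact: measurable_funM.
rewrite (fubini_tonelli1 (fun z : measurableTypeR R * measurableTypeR R =>
  (expR (- ((l * z.1 - complex.Re c) ^+ 2 +
            (l * z.2 - complex.Im c) ^+ 2)))%:E))//=.
  rewrite /fubini_F/=.
  under eq_integral => x _.
    under eq_integral do rewrite opprD expRD EFinM.
    rewrite ge0_integralZl//=.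
    rewrite integral_gauss_affine//.
    over.
  rewrite ge0_integralZr//=; last by rewrite lee_fin divr_ge0// ltW.
  rewrite integral_gauss_affine// -EFinM; congr EFin.
  by rewrite mulf_div -!expr2 sqr_sqrtr// pi_ge0.
exact: measurable_gauss_affineC.
Qed.
Lemma complex_ReM (x y : R[i]) :
  complex.Re (x * y) = complex.Re x * complex.Re y - complex.Im x * complex.Im y.
Proof. by case: x y => ? ? []. Qed.

Lemma complex_ImM (x y : R[i]) :
  complex.Im (x * y) = complex.Re x * complex.Im y + complex.Im x * complex.Re y.
Proof. by case: x y => ? ? []. Qed.

Lemma complex_ReJ (x : R[i]) : complex.Re x^* = complex.Re x.
Proof. by case: x. Qed.

(** The squared modulus, valued in [R] because the norm of [R[i]] takes its values in [R[i]]. *)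
Definition sqn (z : R[i]) : R := complex.Re z ^+ 2 + complex.Im z ^+ 2.

Definition vsq n (v : 'cV[R[i]]_n) : R := \sum_i sqn (v i 0).

Lemma vsqE n (v : 'cV[R[i]]_n) : complex.Re (scal (v^t* *m v)) = vsq v.
Proof.
rewrite /scal mxE raddf_sum; apply: eq_bigr => i _; rewrite !mxE.
by case: (v i 0) => a b /=; rewrite /sqn/=; ring.
Qed.

Lemma vsq_ge0 n (v : 'cV[R[i]]_n) : 0 <= vsq v.
Proof. by apply: sumr_ge0 => i _; rewrite addr_ge0// sqr_ge0. Qed.

Lemma vsq_col_mx m n (u : 'cV[R[i]]_m) (v : 'cV[R[i]]_n) :
  vsq (col_mx u v) = vsq u + vsq v.
Proof.
rewrite /vsq big_split_ord; congr (_ + _); apply: eq_bigr => i _.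
  by rewrite col_mxEu.
by rewrite col_mxEd.
Qed.

End Gaussian.

(** * Measurability of complex matrix-valued maps *)

Section MeasurableMatrix.
Context d (T : measurableType d) (R : realType).
Local Notation C := R[i].

(** Stated on real and imaginary parts, in line with [Cspace], which measures C as R * R. *)
Definition measurable_cfun (f : T -> C) : Prop :=
  measurable_fun setT (fun t => complex.Re (f t)) /\
  measurable_fun setT (fun t => complex.Im (f t)).

Definition measurable_mx m n (F : T -> 'M[C]_(m, n)) : Prop :=
  forall i j, measurable_cfun (fun t => F t i j).

Lemma measurable_mx_cst m n (A : 'M[C]_(m, n)) : measurable_mx (fun=> A).
Proof. by move=> i j; split; exact: measurable_cst. Qed.

Lemma measurable_mxD m n (F G : T -> 'M[C]_(m, n)) :
  measurable_mx F -> measurable_mx G -> measurable_mx (fun t => F t + G t).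
Proof.
move=> mF mG i j; have [? ?] := mF i j; have [? ?] := mG i j.
by split; under eq_fun do rewrite mxE raddfD/=; exact: measurable_funD.
Qed.

Lemma measurable_mxM m n p (F : T -> 'M[C]_(m, n)) (G : T -> 'M[C]_(n, p)) :
  measurable_mx F -> measurable_mx G -> measurable_mx (fun t => F t *m G t).
Proof.
move=> mF mG i j; split; under eq_fun do rewrite mxE raddf_sum/=;
  apply: measurable_sum => k; have [? ?] := mF i k; have [? ?] := mG k j.
- by under eq_fun do rewrite complex_ReM; apply: measurable_funB; apply: measurable_funM.
- by under eq_fun do rewrite complex_ImM; apply: measurable_funD; apply: measurable_funM.
Qed.

Lemma measurable_vsq n (F : T -> 'cV[C]_n) :
  measurable_mx F -> measurable_fun setT (fun t => vsq (F t)).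
Proof.
move=> mF; apply: measurable_sum => k; have [? ?] := mF k 0.
by apply: measurable_funD; apply: measurable_funX.
Qed.

Lemma measurable_Re_scal (F : T -> 'M[C]_1) :
  measurable_mx F -> measurable_fun setT (fun t => complex.Re (scal (F t))).
Proof. by move=> /(_ 0 0)[]. Qed.

Lemma measurable_cvec n (F : T -> n.-tuple (Cspace R)) :
  measurable_fun setT F -> measurable_mx (fun t => cvec (F t)).
Proof.
move=> /measurable_fun_tnthP mF i j; have mFi := mF i.
split; under eq_fun do rewrite mxE/=.
  exact: (measurableT_comp measurable_fst mFi).
exact: (measurableT_comp measurable_snd mFi).
Qed.

End MeasurableMatrix.

(** * Gaussian integrals over C^n with a triangular matrix *)

Section GaussianVector.
Variable R : realType.
Local Notation C := R[i].

Lemma measurable_gauss_vec d (T : measurableType d) m n (L : 'M[C]_(m, n))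
    (c : 'cV[C]_m) (F : T -> n.-tuple (Cspace R)) : measurable_fun setT F ->
  measurable_fun setT (fun t => (expR (- vsq (L *m cvec (F t) - c)))%:E).
Proof.
move=> mF; apply/measurable_EFinP; apply: measurableT_comp => //.
apply: measurableT_comp => //; apply: measurable_vsq.
apply: measurable_mxD; last exact: measurable_mx_cst.
by apply: measurable_mxM; [exact: measurable_mx_cst|exact: measurable_cvec].
Qed.

Lemma cvec_tcons n (x : Cspace R) (t : n.-tuple (Cspace R)) :
  cvec (tcons (x, t)) = col_mx (x.1 +i* x.2)%:M (cvec t) :> 'cV[C]_(1 + n).
Proof.
apply/colP => i; rewrite !mxE; case: splitP => j ij.
  by rewrite ord1 in ij *; rewrite (_ : i = ord0) ?mxE//; exact: val_inj.
rewrite mxE (_ : i = lift ord0 j); first by rewrite tnthS.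
by apply: val_inj; rewrite /= ij.
Qed.

(** Induction on [n], peeling off the first coordinate. Triangularity makes the first row depend on
    that coordinate alone, so the integral is a product of one-variable integrals and no
    multidimensional change of variables occurs. *)
Lemma integral_gauss_trig n (L : 'M[C]_n) (c : 'cV[C]_n) :
  is_trig_mx L -> (forall i, 0 < L i i) ->
  (\int[lebesgueC R n]_t (expR (- vsq (L *m cvec t - c)))%:E =
   (\prod_i (pi / complex.Re (L i i) ^+ 2))%:E)%E.
Proof.
elim: n => [|n IH] in L c *.
  move=> _ _; rewrite integral_tuple_measure0; last exact: measurable_gauss_vec.
  by rewrite /vsq !big_ord0 oppr0 expR0.
move=> Ltrig Lgt0.
rewrite integral_tuple_measureS//; last exact: measurable_gauss_vec.
pose L1 : 'M[C]_(1 + n) := L; pose c1 : 'cV[C]_(1 + n) := c.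
pose l := complex.Re (L 0 0).
have L00 : ulsubmx L1 = (l%:C)%:M.
  apply/matrixP => i j; rewrite !ord1 !mxE eqxx mulr1n.
  rewrite (_ : lshift n 0 = 0 :> 'I_(1 + n)); last exact: val_inj.
  have := Lgt0 0; rewrite /l /L1; case: (L 0 0) => a b /=.
  by rewrite ltcE/= => /andP[/eqP-> _].
have l0 : 0 < l.
  by have := Lgt0 0; rewrite /l; case: (L 0 0) => a b; rewrite ltcE/= => /andP[].
(* The first row gives an affine square in [x]; the column below the corner only moves the centre of
   the Gaussian in the remaining coordinates [t]. *)
have vsqL x t : vsq (L *m cvec (tcons (x, t)) - c) =
   (l * x.1 - complex.Re (c 0 0)) ^+ 2 + (l * x.2 - complex.Im (c 0 0)) ^+ 2 +
   vsq (drsubmx L1 *m cvec t - (dsubmx c1 - dlsubmx L1 *m (x.1 +i* x.2)%:M)).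
  transitivity (vsq (L1 *m col_mx (x.1 +i* x.2)%:M (cvec t) - c1)).
    by rewrite -cvec_tcons.
  rewrite -[in L1 *m _](submxK L1) -[in _ - c1](vsubmxK c1).
  rewrite ursubmx_trig// mul_block_col mul0mx addr0 opp_col_mx add_col_mx vsq_col_mx.
  rewrite L00 -scalar_mxM; congr (_ + _); last by rewrite opprB addrCA addrA.
  rewrite (_ : usubmx c1 = (c 0 0)%:M); last first.
    by apply/matrixP => i j; rewrite !ord1 !mxE eqxx mulr1n; congr (c _ _); exact: val_inj.
  rewrite /vsq big_ord1 /sqn !mxE eqxx !mulr1n.
  by case: (c 0 0) => a b /=; rewrite !mul0r subr0 addr0.
under eq_integral => x _.
  under eq_integral => t _.
    rewrite vsqL opprD expRD EFinM.
    over.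
  rewrite ge0_integralZl//=; last first.
    exact: measurable_gauss_vec.
  (* The value given by [IH] does not depend on the centre, so the inner integral is constant in
     [x]. *)
  rewrite IH; last 2 first.
  - exact: drsubmx_trig.
  - by move=> i; rewrite !mxE; apply: Lgt0.
  over.
rewrite ge0_integralZr//=; last 2 first.
- exact: measurable_gauss_affineC.
- rewrite lee_fin; apply: prodr_ge0 => i _.
  by rewrite divr_ge0 ?pi_ge0// sqr_ge0.
rewrite integral_gauss_affineC// -EFinM big_ord_recl; congr (_ * _)%:E.
apply: eq_bigr => i _; rewrite !mxE; congr (_ / complex.Re (L _ _) ^+ 2); exact: val_inj.
Qed.

(** Completing the square with the scalar matrix [sqrt a] and centre [b / sqrt a] leaves the
    constant [vsq b / a]. *)
Lemma integral_gauss_scalar n (a : R) (b : 'cV[C]_n) : 0 < a ->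
  (\int[lebesgueC R n]_t
     (expR (2 * complex.Re (scal (b^t* *m cvec t)) - a * vsq (cvec t)))%:E =
   ((pi / a) ^+ n * expR (vsq b / a))%:E)%E.
Proof.
move=> a0.
pose L : 'M[C]_n := ((Num.sqrt a)%:C)%:M.
have sa0 : 0 < Num.sqrt a by rewrite sqrtr_gt0.
have E t : 2 * complex.Re (scal (b^t* *m cvec t)) - a * vsq (cvec t) =
    - vsq (L *m cvec t - ((Num.sqrt a)^-1%:C) *: b) + vsq b / a.
  rewrite /scal mxE raddf_sum/= /vsq mulr_sumr mulr_sumr -!sumrN mulr_suml.
  rewrite -!big_split/=; apply: eq_bigr => i _.
  rewrite mul_scalar_mx !mxE /sqn.
  move: (Num.sqrt a) (sqr_sqrtr (ltW a0)) sa0 => r <- r0.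
  case: (b i 0) => x y /=; field.
  by rewrite gt_eqF.
under eq_integral do rewrite E expRD EFinM.
rewrite ge0_integralZr//=; last exact: measurable_gauss_vec.
rewrite integral_gauss_trig; last 2 first.
- exact: scalar_mx_is_trig.
- by move=> i; rewrite mxE eqxx mulr1n ltcR.
rewrite -EFinM; congr (_ * _)%:E.
under eq_bigr do rewrite mxE eqxx mulr1n/= sqr_sqrtr ?(ltW a0)//.
by rewrite prodr_const card_ord.
Qed.

End GaussianVector.


(** * Independence and exponential moments of circular Gaussian vectors *)

Section Laws.
Context d (T : measurableType d) (R : realType) (P : probability T R).
Local Notation C := R[i].

Lemma independent_expectationM d1 d2 (T1 : measurableType d1)
    (T2 : measurableType d2) (X : {RV P >-> T1}) (Y : {RV P >-> T2})
    (f : T1 -> \bar R) (g : T2 -> \bar R) :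
  independent_RV2 X Y ->
  measurable_fun setT f -> (forall x, 0 <= f x)%E ->
  measurable_fun setT g -> (forall y, 0 <= g y)%E ->
  (\int[P]_w (f (X w) * g (Y w)) = \int[P]_w f (X w) * \int[P]_w g (Y w))%E.
Proof.
move=> indep mf f0 mg g0.
have mXY : measurable_fun setT (fun w => (X w, Y w)) by exact: measurable_fun_pair.
pose XY : {mfun T >-> (T1 * T2)%type} := HB.pack (fun w => (X w, Y w))
  (isMeasurableFun.Build _ _ _ _ _ mXY).
pose h (z : T1 * T2) := (f z.1 * g z.2)%E.
have mh : measurable_fun setT h.
  by apply: emeasurable_funM; exact: measurableT_comp.
have h0 z : (0 <= h z)%E by exact: mule_ge0.
transitivity (\int[distribution P XY]_z h z)%E.
  by rewrite ge0_integral_distribution.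
transitivity (\int[(distribution P X \x distribution P Y)%E]_z h z)%E.
  (* By independence the joint law agrees with the product of the marginal laws on rectangles, and
     these determine the product measure. *)
  apply: eq_measure_integral => A mA _; apply/esym.
  exact: product_measure_unique.
rewrite fubini_tonelli1// /fubini_F/h/=.
under eq_integral do rewrite ge0_integralZl//.
rewrite ge0_integralZr//; last by exact: integral_ge0.
by rewrite !ge0_integral_distribution.
Qed.

Lemma CN_ge0_integral s n (X : {RV P >-> n.-tuple (Cspace R)})
    (f : n.-tuple (Cspace R) -> \bar R) : 0 < s -> is_CN s X ->
  measurable_fun setT f -> (forall t, 0 <= f t)%E ->
  (\int[P]_w f (X w) = \int[lebesgueC R n]_t (f t * (cn_pdf s (cvec t))%:E))%E.
Proof.
move=> s0 hX mf f0.
rewrite -(ge0_integral_distribution X)//.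
apply: ge0_integral_density => //.
- rewrite /cn_pdf; apply: measurable_funM => //; apply: measurableT_comp => //.
  apply: measurable_funM => //; apply: measurableT_comp => //.
  under eq_fun do rewrite vsqE.
  by apply: measurable_vsq; exact: measurable_cvec.
- by move=> t; rewrite divr_ge0 ?expR_ge0// exprn_ge0// mulr_ge0 ?pi_ge0// ltW.
Qed.

Lemma measurable_mgf d' (T' : measurableType d') n (h : R) (b : 'cV[C]_n)
    (F : T' -> n.-tuple (Cspace R)) : measurable_fun setT F ->
  measurable_fun setT (fun t => (expR (2 * complex.Re (scal (b^t* *m cvec (F t)))
                                       - h * vsq (cvec (F t))))%:E).
Proof.
move=> mF; have mc := measurable_cvec mF.
apply/measurable_EFinP; apply: measurableT_comp => //; apply: measurable_funB.
  apply: measurable_funM => //; apply: measurable_Re_scal.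
  by apply: measurable_mxM => //; exact: measurable_mx_cst.
by apply: measurable_funM => //; exact: measurable_vsq.
Qed.

(** The parameter [h] adds to the coefficient [1 / s] of the density, so this is again a scalar
    Gaussian integral. It is used at [h = 0] for exponential moments of linear forms and at [b = 0]
    for the Laplace transform of the squared norm. *)
Lemma CN_mgf s n (X : {RV P >-> n.-tuple (Cspace R)}) (h : R) (b : 'cV[C]_n) :
  0 < s -> 0 <= h -> is_CN s X ->
  (\int[P]_w (expR (2 * complex.Re (scal (b^t* *m cvec (X w)))
                    - h * vsq (cvec (X w))))%:E =
   (expR (vsq b / (h + s^-1)) / (1 + h * s) ^+ n)%:E)%E.
Proof.
move=> s0 h0 hX.
have a0 : 0 < h + s^-1 by rewrite ltr_wpDl// invr_gt0.
rewrite (CN_ge0_integral (f := fun t => (expR (2 * complex.Re (scal (b^t* *m cvec t))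
                    - h * vsq (cvec t)))%:E) s0 hX)//; last first.
  exact: measurable_mgf.
under eq_integral => t _.
  rewrite -EFinM /cn_pdf vsqE mulrA -expRD -addrA mulNr -opprD [_ / s]mulrC -mulrDl EFinM.
  over.
rewrite ge0_integralZr//=; last 2 first.
- exact: measurable_mgf.
- by rewrite lee_fin invr_ge0 exprn_ge0// mulr_ge0 ?pi_ge0// ltW.
rewrite integral_gauss_scalar// -EFinM; congr EFin.
rewrite mulrAC mulrC; congr (_ * _).
rewrite -exprVn -exprMn -exprVn; congr (_ ^+ _).
have p0 : pi != 0 :> R by rewrite gt_eqF ?pi_gt0.
move: pi p0 => p p0; field.
by rewrite p0 (gt_eqF s0) gt_eqF//= ltr_wpDr// mulr_ge0// ltW.
Qed.

(** The limit [t -> 0+], in the form in which first-order expansions are exploited below. *)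
Lemma le_of_perturbation (a b c t0 : R) : 0 < t0 -> 0 <= c ->
  (forall t, 0 < t < t0 -> a <= b + t * c) -> a <= b.
Proof.
move=> t00 c0 H; apply/ler_addgt0Pr => e e0.
have c1 : 0 < c + 1 by rewrite ltr_wpDl.
(* The half keeps [t] strictly below [t0]; the [+ 1] covers [c = 0] while still giving
   [t * c <= e]. *)
pose t := Num.min (t0 / 2) (e / (c + 1)).
apply: le_trans (H t _) _.
  rewrite lt_min !divr_gt0//= gt_min; apply/orP; left.
  by rewrite ltr_pdivrMr// ltr_pMr// ltr1n.
rewrite lerD2l (@le_trans _ _ (e / (c + 1) * c))//.
  by rewrite ler_wpM2r// ge_min lexx orbT.
by rewrite mulrAC ler_pdivrMr// ler_pM2l// lerDl.
Qed.

(** The lower bound on the trace of the covariance, to be met by upper bounds on each coordinate. An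
    infinite integral satisfies it trivially, so the argument concerns a finite value [A]. *)
Lemma CN_vsq_ge s n (X : {RV P >-> n.-tuple (Cspace R)}) :
  0 < s -> is_CN s X ->
  ((n%:R * s)%:E <= \int[P]_w (vsq (cvec (X w)))%:E)%E.
Proof.
move=> s0 hX.
have mv : measurable_fun setT (fun w => vsq (cvec (X w))).
  by apply: measurable_vsq; exact: measurable_cvec.
have ge0I : (0 <= \int[P]_w (vsq (cvec (X w)))%:E)%E.
  by apply: integral_ge0 => w _; rewrite lee_fin vsq_ge0.
case EA : (\int[P]_w (vsq (cvec (X w)))%:E)%E ge0I => [A| |] // A0; last by rewrite leey.
rewrite !lee_fin in A0 *.
have ns0 : 0 <= n%:R * s by rewrite mulr_ge0// ltW.
apply: (@le_of_perturbation _ _ (n%:R * s * A) 1) => //; first by rewrite mulr_ge0.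
move=> h /andP[h0 _].
(* [1 <= E (exp (- h v) + h v) = (1 + h s)^-n + h E v] for [v = |X|^2]. *)
have : (1 <= \int[P]_w ((expR (2 * complex.Re (scal ((0 : 'cV[C]_n)^t* *m cvec (X w)))
                    - h * vsq (cvec (X w))))%:E + (h%:E * (vsq (cvec (X w)))%:E)))%E.
  rewrite -[leLHS](@probability_setT _ _ _ P) -[leLHS]mul1e -integral_cst//.
  apply: ge0_le_integral => //.
  - apply: emeasurable_funD; first exact: measurable_mgf.
    by apply: measurable_funeM; exact/measurable_EFinP.
  - move=> w _; rewrite -EFinM -EFinD lee_fin.
    rewrite raddf0 map_mx0 mul0mx /scal mxE/= mulr0 add0r -lerBlDr.
    by apply: le_trans (expR_ge1Dx _).
rewrite ge0_integralD//=; last 3 first.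
- exact: measurable_mgf.
- by move=> w _; rewrite -EFinM lee_fin mulr_ge0 ?vsq_ge0 ?ltW.
- by apply: measurable_funeM; exact/measurable_EFinP.
rewrite (CN_mgf _ s0 (ltW h0) hX) ge0_integralZl//=; last 3 first.
- exact/measurable_EFinP.
- by move=> w _; rewrite lee_fin vsq_ge0.
- by rewrite lee_fin ltW.
rewrite EA -EFinM -EFinD lee_fin.
have -> : vsq (0 : 'cV[C]_n) = 0.
  by apply: big1 => i _; rewrite mxE /sqn/= expr0n addr0.
rewrite mul0r expR0 => H.
(* Bernoulli's inequality. *)
have B : 1 + h * (n%:R * s) <= (1 + h * s) ^+ n.
  have hs0 : 0 <= h * s by rewrite mulr_ge0// ltW.
  elim: (n) => [|k IH]; first by rewrite mul0r mulr0 addr0 expr0.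
  rewrite exprS (le_trans _ (ler_wpM2l _ IH)) ?addr_ge0//.
  have : 0 <= (h * s) * (h * (k%:R * s)) by rewrite !mulr_ge0// ltW.
  by rewrite -natr1; lra.
have D0 : 0 < 1 + h * (n%:R * s) by rewrite ltr_wpDr// mulr_ge0// ltW.
have : 1 <= 1 / (1 + h * (n%:R * s)) + h * A.
  by apply: le_trans H _; rewrite lerD2r !div1r lef_pV2 ?posrE// (lt_le_trans D0).
(* Clearing the denominator and dividing by [h] leaves [n s <= A + h (n s A)], the perturbed
   bound. *)
rewrite -(ler_pM2r D0) [leRHS]mulrDl divfK ?gt_eqF// mul1r.
rewrite lerD2l -[h * A * _]mulrA ler_pM2l//.
by rewrite mulrDr mulr1 mulrCA [A * _]mulrC.
Qed.

Lemma CN_joint_mgf (s r : R) n m (X : {RV P >-> n.-tuple (Cspace R)})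
   (W : {RV P >-> m.-tuple (Cspace R)}) (b : 'cV[C]_n) (c : 'cV[C]_m) :
  0 < s -> 0 < r -> is_CN s X -> is_CN r W -> independent_RV2 X W ->
  (\int[P]_w (expR (2 * complex.Re (scal ((col_mx b c)^t* *m
                        col_mx (cvec (X w)) (cvec (W w))))))%:E =
   (expR (s * vsq b + r * vsq c))%:E)%E.
Proof.
move=> s0 r0 hX hW XW.
(* The exponent is a sum of a form in [X] and one in [W]. The terms [0 * vsq] give each factor the
   shape of [CN_mgf] at [h = 0]. *)
have E w : (expR (2 * complex.Re (scal ((col_mx b c)^t* *m
    col_mx (cvec (X w)) (cvec (W w))))))%:E =
    ((expR (2 * complex.Re (scal (b^t* *m cvec (X w))) - 0 * vsq (cvec (X w))))%:E *
    (expR (2 * complex.Re (scal (c^t* *m cvec (W w))) - 0 * vsq (cvec (W w))))%:E)%E.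
  rewrite -EFinM -expRD !mul0r !subr0 -mulrDr; congr (expR (2 * _))%:E.
  by rewrite tr_col_mx map_row_mx mul_row_col /scal mxE raddfD.
under eq_integral do rewrite E.
rewrite (independent_expectationM (X := X) (Y := W)
  (f := fun t => (expR (2 * complex.Re (scal (b^t* *m cvec t)) - 0 * vsq (cvec t)))%:E)
  (g := fun t => (expR (2 * complex.Re (scal (c^t* *m cvec t)) - 0 * vsq (cvec t)))%:E))//;
  try exact: measurable_mgf.
rewrite (CN_mgf b s0 _ hX)// (CN_mgf c r0 _ hW)// !add0r !mul0r !addr0 !expr1n !divr1 !invrK.
by rewrite -EFinM -expRD [vsq b * _]mulrC [vsq c * _]mulrC.
Qed.

End Laws.

(** * Second moments and covariances from exponential moments *)

Section SecondMoment.

(** The difference [exp x + exp (-x) - 2] is the square of [exp (x/2) - exp (-x/2)], which is at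
    least [x] for [x >= 0]. The latter is the mean value theorem: [exp z + exp (-z) - 2 = (exp z -
    1)^2 / exp z] is nonnegative. *)
Lemma cosh_ge (R : realType) (x : R) : x ^+ 2 + 2 <= expR x + expR (- x).
Proof.
have sinh_ge (y : R) : 0 <= y -> 2 * y <= expR y - expR (- y).
  rewrite le_eqVlt => /predU1P[<-|y0]; first by rewrite oppr0 mulr0 subrr.
  pose f (z : R) := expR z - expR (- z) - 2 * z.
  have df (z : R) : is_derive z 1 f (expR z + expR (- z) - 2).
    apply: is_derive_eq.
    by rewrite mulrN1 opprK /GRing.scale/= mulr1.
  have [|z _] := @MVT _ f (fun z => expR z + expR (- z) - 2) _ _ y0 (fun z _ => df z).
    apply: continuous_subspaceT => z; apply: differentiable_continuous.
    by apply/derivable1_diffP; have [] := df z.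
  rewrite /f oppr0 subrr mulr0 subr0 subr0 => E.
  rewrite addr0 in E; rewrite -subr_ge0 E; apply: mulr_ge0; last exact: ltW.
  have := expR_gt0 z; rewrite expRN; move: (expR z) => r r0.
  rewrite (_ : r + r^-1 - 2 = (r - 1) ^+ 2 / r); last by field; rewrite gt_eqF.
  by rewrite divr_ge0 ?sqr_ge0// ltW.
wlog x0 : x / 0 <= x.
  move=> H; have [/H//|/ltW x0] := leP 0 x.
  by rewrite -sqrrN addrC [leRHS]addrC -[X in _ <= _ + expR X]opprK [leLHS]addrC H ?oppr_ge0.
have h : 0 <= x / 2 by rewrite divr_ge0.
have := sinh_ge _ h; rewrite [2 * _]mulrC divfK// => H.
rewrite -lerBrDr (_ : _ - 2 = (expR (x / 2) - expR (- (x / 2))) ^+ 2).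
  by rewrite lerXn2r ?nnegrE// (le_trans x0).
rewrite {1 2}(splitr x) opprD !expRD !expRN.
have := expR_gt0 (x / 2); move: (expR _) => r r0; field; rewrite gt_eqF//.
Qed.

Context d (T : measurableType d) (R : realType) (P : probability T R).

(** Integrability travels with a real value of the mean, so linear combinations carry no separate
    integrability obligations. *)
Definition has_mean (f : T -> R) (r : R) : Prop :=
  P.-integrable setT (EFin \o f) /\ (\int[P]_w (f w)%:E = r%:E)%E.

Lemma has_mean_cst r : has_mean (fun=> r) r.
Proof.
split; first exact: finite_measure_integrable_cst.
by rewrite integral_cst//= probability_setT mule1.
Qed.

Lemma has_meanD f g r s :
  has_mean f r -> has_mean g s -> has_mean (fun w => f w + g w) (r + s).
Proof.
move=> [fi fE] [gi gE]; split; first exact: (integrableD _ fi gi).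
rewrite EFinD -fE -gE; exact: (integralD_EFin _ fi gi).
Qed.

Lemma has_meanZ k f r : has_mean f r -> has_mean (fun w => k * f w) (k * r).
Proof.
move=> [fi fE]; split; first exact: (integrableZl _ _ fi).
by rewrite EFinM -fE -integralZl.
Qed.

Lemma has_mean_sum (I : finType) (f : I -> T -> R) (r : I -> R) :
  (forall i, has_mean (f i) (r i)) ->
  has_mean (fun w => \sum_i f i w) (\sum_i r i).
Proof.
move=> h; elim: (index_enum I) => [|i s IH].
  by rewrite big_nil; under eq_fun do rewrite big_nil; exact: has_mean_cst.
by rewrite big_cons; under eq_fun do rewrite big_cons; exact: has_meanD.
Qed.

Lemma has_mean_unique f r s : has_mean f r -> has_mean f s -> r = s.
Proof. by move=> [_ fr] [_ fs]; apply: EFin_inj; rewrite -fr -fs. Qed.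

Lemma has_mean_le f g r s :
  has_mean f r -> has_mean g s -> (forall w, f w <= g w) -> r <= s.
Proof.
move=> [fi fE] [gi gE] fg; rewrite -lee_fin -fE -gE.
by apply: le_integral => // w _; rewrite lee_fin.
Qed.

Lemma has_mean_dominated (f g : T -> R) s : measurable_fun setT f ->
  (forall w, `|f w| <= g w) -> has_mean g s -> exists r, has_mean f r.
Proof.
move=> mf fg [gi _].
have fi : P.-integrable setT (EFin \o f).
  apply: le_integrable gi => //; first exact/measurable_EFinP.
  by move=> w _; rewrite /= lee_fin (le_trans (fg w))// ler_norm.
exists (fine (\int[P]_w (f w)%:E)); split => //.
by rewrite fineK//; exact: integrable_fin_num.
Qed.

Lemma has_mean_ge0 (f : T -> R) r : measurable_fun setT f -> (forall w, 0 <= f w) ->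
  (\int[P]_w (f w)%:E = r%:E)%E -> has_mean f r.
Proof.
move=> mf f0 fE; split => //; apply/integrableP; split.
  exact/measurable_EFinP.
under eq_integral do rewrite /= ger0_norm//.
by rewrite fE ltry.
Qed.

(** Averaging [cosh_ge] at [h u] gives [h^2 E u^2 + 2 <= 2 exp (h^2 q)], and [h -> 0] yields the
    bound. The case [h = 1] also dominates [u^2], which proves it integrable. *)
Lemma second_moment_le_of_mgf (u : T -> R) (q : R) : measurable_fun setT u ->
  (forall h : R, \int[P]_w (expR (h * u w))%:E = (expR (h ^+ 2 * q))%:E)%E ->
  exists2 r, has_mean (fun w => u w ^+ 2) r & r <= 2 * q.
Proof.
move=> mu mgf.
have me h : has_mean (fun w => expR (h * u w)) (expR (h ^+ 2 * q)).
  apply: has_mean_ge0 => //.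
  by apply: measurableT_comp => //; exact: measurable_funM.
have mc h := has_meanD (me h) (me (- h)).
have cosh h w : (h * u w) ^+ 2 + 2 <= expR (h * u w) + expR (- h * u w).
  by rewrite mulNr cosh_ge.
have [r hr] : exists r, has_mean (fun w => u w ^+ 2) r.
  apply: has_mean_dominated (mc 1); first exact: measurable_funX.
  move=> w; rewrite ger0_norm ?sqr_ge0//.
  by have := cosh 1 w; rewrite mul1r; apply: le_trans; rewrite lerDl.
exists r => //.
have r0 : 0 <= r.
  by apply: has_mean_le (has_mean_cst 0) hr _ => w; exact: sqr_ge0.
have H h : h ^+ 2 * r + 2 <= 2 * expR (h ^+ 2 * q).
  have := has_mean_le (has_meanD (has_meanZ (h ^+ 2) hr) (has_mean_cst 2)) (mc h).
  by rewrite sqrrN mulr_natl mulr2n; apply => w; rewrite -exprMn.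
have q0 : 0 <= q.
  have := H 1; rewrite expr1n !mul1r => H1.
  by rewrite leNgt -expR_lt1 -leNgt; lra.
(* Here [t = h^2]. Below [1 / (q + 1)] one has [t q < 1], so [H] may be multiplied by
   [1 - t q <= exp (- t q)]; this gives [(1 - t q) (t r + 2) <= 2], that is [r <= 2 q + t q r]. *)
apply: (@le_of_perturbation _ _ _ (q * r) (q + 1)^-1) => //.
- by rewrite invr_gt0 ltr_wpDl.
- by rewrite mulr_ge0.
move=> t /andP[t0 tq].
have tq1 : t * q < 1.
  have : t * (q + 1) < 1 by rewrite -ltr_pdivlMr ?div1r// ltr_wpDl.
  by nra.
have := H (Num.sqrt t); rewrite sqr_sqrtr ?(ltW t0)// => Ht.
have := expR_ge1Dx (- (t * q)); rewrite expRN => Ge.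
have E0 := expR_gt0 (t * q).
have H1 : (1 - t * q) * expR (t * q) <= 1 by rewrite -ler_pdivlMr// div1r.
have H2 : (1 - t * q) * (t * r + 2) <= (1 - t * q) * (2 * expR (t * q)).
  by rewrite ler_wpM2l// subr_ge0 ltW.
rewrite -subr_le0 -(pmulr_rle0 _ t0).
by nra.
Qed.

(** The exponential moments are those of uncorrelated real Gaussians of variances [sg]; their
    covariance is obtained from inequalities alone, without differentiating under the integral. *)
Lemma covariance_of_mgf (J : finType) (U : J -> T -> R) (sg : J -> R) :
  (forall j, measurable_fun setT (U j)) ->
  (forall a : J -> R, \int[P]_w (expR (\sum_j a j * U j w))%:E =
     (expR (\sum_j sg j * a j ^+ 2 / 2))%:E)%E ->
  ((\sum_j sg j)%:E <= \int[P]_w (\sum_j U j w ^+ 2)%:E)%E ->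
  forall i j, has_mean (fun w => U i w * U j w) (if i == j then sg i else 0).
Proof.
move=> mU mgf lb.
(* Polarization: the upper bound for every [a] is attained on the coordinates,
   hence the mean of [2 * ep * U i * U j] is nonpositive for both signs [ep]. *)
have le_lin (a : J -> R) : exists r, has_mean (fun w => (\sum_j a j * U j w) ^+ 2) r /\
    r <= \sum_j sg j * a j ^+ 2.
  have [||r hr hle] := @second_moment_le_of_mgf (fun w => \sum_j a j * U j w)
      (\sum_j sg j * a j ^+ 2 / 2).
  - by apply: measurable_sum => j; exact: measurable_funM.
  - move=> h; have := mgf (fun j => h * a j).
    under eq_integral do under eq_bigr do rewrite -mulrA.
    under eq_integral do rewrite -mulr_sumr.
    move=> ->; congr (expR _)%:E; rewrite mulr_sumr; apply: eq_bigr => j _.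
    by rewrite exprMn; ring.
  exists r; split=> //; apply: le_trans hle _.
  rewrite mulr_sumr; apply: ler_sum => j _.
  by rewrite mulrC divfK.
pose e (i j : J) : R := (j == i)%:R.
have sume i (g : J -> R) : \sum_j e i j * g j = g i.
  rewrite (bigD1 i)//= /e eqxx mul1r big1 ?addr0// => j /negPf->.
  by rewrite mul0r.
have /choice[r hr] : forall i, exists r, has_mean (fun w => U i w ^+ 2) r /\ r <= sg i.
  move=> i; have [r [hr rle]] := le_lin (e i); exists r; split.
    by move: hr; under eq_fun do rewrite sume.
  apply: le_trans rle _; rewrite (eq_bigr (fun j => e i j * sg j)) ?sume// => j _.
  by rewrite /e; case: eqP => _; rewrite ?expr1n ?expr0n ?mulr1 ?mul1r// mulr0 mul0r.
(* Each [r j] is at most [sg j], while by [lb] their sum is at least the sum of [sg]; hence equality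
   term by term. *)
have rsg i : r i = sg i.
  have hs := has_mean_sum (fun j => (hr j).1).
  rewrite hs.2 lee_fin in lb.
  apply/eqP; rewrite eq_le (hr i).2/=.
  rewrite (bigD1 i)//= [leRHS](bigD1 i)//= in lb.
  have : \sum_(j | j != i) r j <= \sum_(j | j != i) sg j.
    by apply: ler_sum => j _; exact: (hr j).2.
  by lra.
move=> i j; case: eqVneq => [<-|ij].
  by have := (hr i).1; rewrite rsg.
have hi := (hr i).1; have hj := (hr j).1; rewrite !rsg in hi hj.
have [c hc] : exists c, has_mean (fun w => U i w * U j w) c.
  apply: has_mean_dominated (has_meanD hi hj); first exact: measurable_funM.
  by move=> w; rewrite ler_norml; apply/andP; split; nra.
have cle (ep : R) : ep ^+ 2 = 1 -> ep * c <= 0.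
  move=> ep1; have [s [hs sle]] := le_lin (fun k => e i k + ep * e j k).
  have hs' : has_mean (fun w => U i w ^+ 2 + U j w ^+ 2 + (2 * ep) * (U i w * U j w)) s.
    move: hs; under eq_fun do under eq_bigr do rewrite mulrDl -mulrA.
    under eq_fun do rewrite big_split/= -mulr_sumr !sume.
    rewrite (_ : (fun w => (_ : R)) = fun w =>
      U i w ^+ 2 + U j w ^+ 2 + (2 * ep) * (U i w * U j w))//.
    apply/funext => w.
    by rewrite sqrrD exprMn ep1 mul1r; ring.
  have := has_mean_unique hs' (has_meanD (has_meanD hi hj) (has_meanZ (2 * ep) hc)).
  have : \sum_k sg k * (e i k + ep * e j k) ^+ 2 = sg i + sg j.
    rewrite (eq_bigr (fun k => e i k * sg k + e j k * sg k)) ?big_split/= ?sume// => k _.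
    rewrite /e; case: (eqVneq k i) => [->|_].
      by rewrite (negbTE ij) mulr0 addr0 expr1n mulr1 mul1r mul0r addr0.
    by case: eqP => _; rewrite ?mulr1 ?mulr0 add0r ?ep1 ?expr0n/= ?mulr1 ?mulr0
      !mul0r ?mul1r ?addr0 ?add0r.
  by move=> E1 E2; lra.
have := cle 1 (expr1n _ _); have := cle (-1) (sqrr_sign _ 1).
rewrite mul1r mulN1r oppr_le0 => c0 c0'.
by rewrite (_ : 0 = c)//; apply: le_anti; rewrite c0 c0'.
Qed.

End SecondMoment.

(** * Means of quadratic forms in a complex Gaussian vector *)

Section ComplexCovariance.
Context d (T : measurableType d) (R : realType) (P : probability T R).
Local Notation C := R[i].

(** Passing to real coordinates, the real and imaginary parts of [Z k] are uncorrelated, each of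
    variance [v k / 2]. Only the diagonal of [A] survives, and its imaginary part multiplies a
    commutator that is zero. *)
Lemma mean_quadratic_form K (Z : T -> 'cV[C]_K) (v : 'I_K -> R) (A : 'M[C]_K) :
  measurable_mx Z ->
  (forall b : 'cV[C]_K,
    \int[P]_w (expR (2 * complex.Re (scal (b^t* *m Z w))))%:E =
    (expR (\sum_k v k * sqn (b k 0)))%:E)%E ->
  ((\sum_k v k)%:E <= \int[P]_w (vsq (Z w))%:E)%E ->
  has_mean P (fun w => complex.Re (scal ((Z w)^t* *m A *m Z w)))
    (\sum_k v k * complex.Re (A k k)).
Proof.
move=> mZ mgf lb.
(* Real coordinates: the flag [true] selects the imaginary part. *)
pose U (j : 'I_K * bool) w :=
  if j.2 then complex.Im (Z w j.1 0) else complex.Re (Z w j.1 0).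
have sum2 (F : 'I_K * bool -> R) : \sum_j F j = \sum_k (F (k, false) + F (k, true)).
  rewrite (eq_bigr (fun j => F (j.1, j.2))); last by case.
  rewrite -(pair_bigA _ (fun k b => F (k, b)))/=; apply: eq_bigr => k _.
  by rewrite big_bool addrC.
have cov := @covariance_of_mgf _ _ _ P _ U (fun j => v j.1 / 2).
have {}cov : forall i j, has_mean P (fun w => U i w * U j w)
    (if i == j then v i.1 / 2 else 0).
  apply: cov => [[k []]|a|]; try by have [] := mZ k 0.
    (* Halving the entries absorbs the factor 2 in front of the real part; [v * sqn] then becomes
       [(v / 2) a^2 / 2] for each real coordinate. *)
    have := mgf (\col_k ((a (k, false) / 2) +i* (a (k, true) / 2))).
    under eq_integral => w _.
      rewrite (_ : 2 * _ = \sum_j a j * U j w); last first.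
        rewrite sum2 /scal mxE raddf_sum/= mulr_sumr; apply: eq_bigr => k _.
        by rewrite !mxE /U/=; case: (Z w k 0) => x y /=; field.
      over.
    move=> ->; congr (expR _)%:E; rewrite sum2; apply: eq_bigr => k _.
    by rewrite mxE /sqn/=; field.
  rewrite sum2; under eq_bigr do rewrite -splitr.
  apply: le_trans lb _; rewrite le_eqVlt; apply/orP; left; apply/eqP.
  by apply: eq_integral => w _; rewrite sum2.
have -> : (fun w => complex.Re (scal ((Z w)^t* *m A *m Z w))) = fun w =>
    \sum_k \sum_l (complex.Re (A k l) * (U (k, false) w * U (l, false) w
       + U (k, true) w * U (l, true) w) +
     (- complex.Im (A k l)) * (U (k, false) w * U (l, true) w
       + (-1) * (U (k, true) w * U (l, false) w))).
  apply/funext => w; rewrite /scal mxE raddf_sum/= exchange_big/=.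
  apply: eq_bigr => k _; rewrite mxE mulr_suml raddf_sum/=; apply: eq_bigr => l _.
  rewrite !mxE /U/=; case: (Z w l 0) (Z w k 0) (A l k) => x y [x' y'] [a b] /=.
  ring.
(* The claimed mean is padded to the same double sum, each product of coordinates being replaced by
   its covariance, so that linearity applies term by term. *)
have -> : \sum_k v k * complex.Re (A k k) = \sum_k \sum_l
   (complex.Re (A k l) * ((if (k, false) == (l, false) then v k / 2 else 0) +
     (if (k, true) == (l, true) then v k / 2 else 0)) +
     (- complex.Im (A k l)) * (0 + (-1) * 0)).
  apply: eq_bigr => k _; rewrite (bigD1 k)//= !eqxx big1 ?addr0.
    by rewrite -splitr mulr0 addr0 mulr0 addr0 mulrC.
  move=> l lk; rewrite !xpair_eqE !andbT [k == l]eq_sym (negbTE lk).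
  by rewrite addr0 !mulr0 addr0 mulr0 addr0.
apply: has_mean_sum => k; apply: has_mean_sum => l.
apply: has_meanD; apply: has_meanZ; apply: has_meanD; try exact: cov.
  by have := cov (k, false) (l, true); rewrite xpair_eqE andbF.
by apply: has_meanZ; have := cov (k, true) (l, false); rewrite xpair_eqE andbF.
Qed.

(** The stacked vector has variance [s] on its first [n] coordinates and [r] on the last [m], so the
    weighted diagonal of [A] splits into two block traces. *)
Lemma CN_mean_quadratic_form (s r : R) n m (X : {RV P >-> n.-tuple (Cspace R)})
    (W : {RV P >-> m.-tuple (Cspace R)}) (A : 'M[C]_(n + m)) :
  0 < s -> 0 < r -> is_CN s X -> is_CN r W -> independent_RV2 X W ->
  has_mean P (fun w => complex.Re (scal ((col_mx (cvec (X w)) (cvec (W w)))^t* *m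
      A *m col_mx (cvec (X w)) (cvec (W w)))))
    (s * complex.Re (\tr (ulsubmx A)) + r * complex.Re (\tr (drsubmx A))).
Proof.
move=> s0 r0 hX hW XW.
pose v (k : 'I_(n + m)) := if fintype.split k is inl _ then s else r.
have vl i : v (lshift m i) = s by rewrite /v (unsplitK (inl i)).
have vr i : v (rshift n i) = r by rewrite /v (unsplitK (inr i)).
have -> : s * complex.Re (\tr (ulsubmx A)) + r * complex.Re (\tr (drsubmx A)) =
    \sum_k v k * complex.Re (A k k).
  rewrite big_split_ord/= !raddf_sum/= !mulr_sumr.
  by congr (_ + _); apply: eq_bigr => i _; rewrite ?vl ?vr !mxE.
have mX : measurable_mx (fun w => cvec (X w)) by exact: measurable_cvec.
have mW : measurable_mx (fun w => cvec (W w)) by exact: measurable_cvec.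
apply: mean_quadratic_form.
- move=> k j; rewrite -[k]splitK; case: (fintype.split k) => i /=.
    by under eq_fun do rewrite col_mxEu; exact: mX.
  by under eq_fun do rewrite col_mxEd; exact: mW.
- move=> b; have mgf := CN_joint_mgf (usubmx b) (dsubmx b) s0 r0 hX hW XW.
  rewrite vsubmxK in mgf; rewrite mgf big_split_ord /vsq !mulr_sumr/=.
  apply: (congr1 (fun z => (expR z)%:E)).
  by congr (_ + _); apply: eq_bigr => i _; rewrite ?vl ?vr mxE.
- under eq_integral do rewrite vsq_col_mx EFinD.
  rewrite ge0_integralD//=; last 4 first.
  - by move=> w _; rewrite lee_fin vsq_ge0.
  - exact/measurable_EFinP/measurable_vsq.
  - by move=> w _; rewrite lee_fin vsq_ge0.
  - exact/measurable_EFinP/measurable_vsq.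
  rewrite big_split_ord/= EFinD; apply: leeD.
    under eq_bigr do rewrite vl.
    by rewrite sumr_const card_ord -mulr_natl; exact: CN_vsq_ge.
  under eq_bigr do rewrite vr.
  by rewrite sumr_const card_ord -mulr_natl; exact: CN_vsq_ge.
Qed.

End ComplexCovariance.

(** * The output density and the two means in the rate *)

Section MatrixAlgebra.
Variable R : realType.
Local Notation C := R[i].

Lemma Re_scalD (A B : 'M[C]_1) :
  complex.Re (scal (A + B)) = complex.Re (scal A) + complex.Re (scal B).
Proof. by rewrite /scal mxE raddfD. Qed.

Lemma Re_scalN (A : 'M[C]_1) : complex.Re (scal (- A)) = - complex.Re (scal A).
Proof. by rewrite /scal mxE raddfN. Qed.

Lemma adjM m n p (A : 'M[C]_(m, n)) (B : 'M[C]_(n, p)) :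
  (A *m B)^t* = B^t* *m A^t*.
Proof. by rewrite trmx_mul map_mxM. Qed.

Lemma adjK m n (A : 'M[C]_(m, n)) : (A^t*)^t* = A.
Proof. by apply/matrixP => i j; rewrite !mxE conjCK. Qed.

Lemma adjD m n (A B : 'M[C]_(m, n)) : (A + B)^t* = A^t* + B^t*.
Proof. by rewrite raddfD/= map_mxD. Qed.

Lemma adjN m n (A : 'M[C]_(m, n)) : (- A)^t* = - A^t*.
Proof. by rewrite raddfN/= map_mxN. Qed.

Lemma Re_scal_adj (A : 'M[C]_1) : complex.Re (scal (A^t*)) = complex.Re (scal A).
Proof. by rewrite /scal !mxE complex_ReJ. Qed.

Lemma vsqB n (u v : 'cV[C]_n) :
  vsq (u - v) = vsq u - 2 * complex.Re (scal (v^t* *m u)) + vsq v.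
Proof.
rewrite -!vsqE adjD adjN mulmxDl !mulmxDr !mulNmx !mulmxN opprK.
have -> : v^t* *m u = (u^t* *m v)^t* by rewrite adjM adjK.
move: (u^t* *m u) (u^t* *m v) (v^t* *m v) => a b c.
by rewrite !(Re_scalD, Re_scalN, Re_scal_adj); ring.
Qed.

(** The term [x^t* x / Es] of the metric cancels the exponent of the prior. What remains is
    [vsq c - vsq (L x - c)], a triangular Gaussian integral whose powers of pi cancel those of the
    prior. *)
Lemma p_outE M N (Es N0 : R) (H : 'M[C]_(M, N)) (L : 'M[C]_N) (y : 'cV[C]_M) :
  0 < Es -> is_trig_mx L -> (forall i, 0 < L i i) ->
  p_out Es N0 H L y =
  (expR (vsq (L *m (mmse Es N0 H *m y))) /
     (Es ^+ N * \prod_i (complex.Re (L i i) ^+ 2)))%:E.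
Proof.
move=> Es0 Ltrig Lgt0; rewrite /p_out.
set c := L *m (mmse Es N0 H *m y).
have E t : p_cond Es N0 H L y (cvec t) * cn_pdf Es (cvec t) =
    expR (- vsq (L *m cvec t - c)) * (expR (vsq c) / (pi * Es) ^+ N).
  rewrite /p_cond /cn_pdf /c /Fap /Gap; move: (mmse Es N0 H) => W.
  set x := cvec t.
  have -> : scal (y^t* *m (W^t* *m (L^t* *m L)) *m x) =
      scal ((L *m (W *m y))^t* *m (L *m x)) by rewrite !adjM !mulmxA.
  have -> : complex.Re (scal (x^t* *m (L^t* *m L) *m x)) = vsq (L *m x).
    by rewrite -vsqE adjM !mulmxA.
  rewrite mulrA -expRD [RHS]mulrA -expRD vsqB vsqE; apply: (congr1 (fun z => expR z / _)).
  by ring.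
under eq_integral do rewrite E EFinM.
rewrite ge0_integralZr//=; last 2 first.
- exact: measurable_gauss_vec.
- by rewrite lee_fin divr_ge0 ?expR_ge0// exprn_ge0// mulr_ge0 ?pi_ge0// ltW.
rewrite integral_gauss_trig// -EFinM; apply: (congr1 EFin).
have -> : \prod_i (pi / complex.Re (L i i) ^+ 2) =
    pi ^+ N / \prod_i (complex.Re (L i i) ^+ 2) :> R.
  by rewrite big_split/= prodr_const card_ord -prodfV.
have p0 : pi ^+ N != 0 :> R by rewrite expf_neq0// gt_eqF ?pi_gt0.
have e0 : Es ^+ N != 0 by rewrite expf_neq0// gt_eqF.
have q0 : \prod_i complex.Re (L i i) ^+ 2 != 0.
  apply/prodf_neq0 => i _; rewrite expf_neq0//.
  by have := Lgt0 i; case: (L i i) => a b; rewrite ltcE/= => /andP[_ /gt_eqF->].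
rewrite exprMn; move: (expR _) (\prod_i _) q0 (Es ^+ N) e0 (pi ^+ N) p0.
by move=> a q q0 e e0 p p0; field; rewrite p0 e0 q0.
Qed.

Lemma quadratic_block n m (A : 'M[C]_n) (B : 'M[C]_(n, m)) (D : 'M[C]_(m, n))
    (E : 'M[C]_m) (x : 'cV[C]_n) (w : 'cV[C]_m) :
  (col_mx x w)^t* *m block_mx A B D E *m col_mx x w =
  x^t* *m A *m x + x^t* *m B *m w + w^t* *m D *m x + w^t* *m E *m w.
Proof.
rewrite tr_col_mx map_row_mx mul_row_block mul_row_col !mulmxDl.
by rewrite -!addrA; congr (_ + _); rewrite addrCA.
Qed.

Lemma Re_scalZ (a : R) (A : 'M[C]_1) :
  complex.Re (scal (a%:C *: A)) = a * complex.Re (scal A).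
Proof. by rewrite /scal mxE complex_ReM/= mul0r subr0. Qed.

(** Since only the real part is taken, the cross term is placed whole in the lower left block
    instead of being symmetrised with its adjoint. *)
Lemma metric_quadratic_form M N (s : R) (H F : 'M[C]_(M, N)) (G : 'M[C]_N)
    (x : 'cV[C]_N) (w : 'cV[C]_M) :
  complex.Re (scal ((col_mx x w)^t* *m
    block_mx ((H^t* *m F) *+ 2 - G + s%:C%:M) 0 (F *+ 2) 0 *m col_mx x w)) =
  2 * complex.Re (scal ((H *m x + w)^t* *m F *m x))
  - complex.Re (scal (x^t* *m G *m x)) + s * complex.Re (scal (x^t* *m x)).
Proof.
rewrite quadratic_block !mulmx0 !mul0mx !addr0 adjD adjM !mulr2n.
rewrite !(mulmxDl, mulmxDr, mulmxN, mulNmx) mul_mx_scalar -scalemxAl !mulmxA.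
move: (x^t* *m H^t* *m F *m x) (x^t* *m G *m x) (x^t* *m x) (w^t* *m F *m x).
by move=> a b c e; rewrite !(Re_scalD, Re_scalN, Re_scalZ); ring.
Qed.

Lemma mean_ln_p_cond M N (Es N0 : R) (H : 'M[C]_(M, N)) (L : 'M[C]_N)
    d (T : measurableType d) (P : probability T R)
    (X : {RV P >-> N.-tuple (Cspace R)}) (W : {RV P >-> M.-tuple (Cspace R)}) :
  0 < Es -> 0 < N0 -> is_CN Es X -> is_CN N0 W -> independent_RV2 X W ->
  has_mean P (fun w => ln (p_cond Es N0 H L (H *m cvec (X w) + cvec (W w)) (cvec (X w))))
    (Es * complex.Re (\tr ((H^t* *m Fap Es N0 H L) *+ 2 - Gap L + (Es^-1)%:C%:M))).
Proof.
move=> Es0 N00 hX hW XW.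
have := CN_mean_quadratic_form (block_mx
  ((H^t* *m Fap Es N0 H L) *+ 2 - Gap L + (Es^-1)%:C%:M) 0 (Fap Es N0 H L *+ 2) 0)
  Es0 N00 hX hW XW.
rewrite block_mxKul block_mxKdr mxtrace0/= mulr0 addr0.
move=> hm; congr has_mean: hm; apply/funext => w.
by rewrite /p_cond expRK metric_quadratic_form.
Qed.

Lemma output_quadratic_form M N (H : 'M[C]_(M, N)) (K : 'M[C]_(N, M))
    (x : 'cV[C]_N) (w : 'cV[C]_M) :
  let G := K^t* *m K in
  (col_mx x w)^t* *m block_mx (H^t* *m G *m H) (H^t* *m G) (G *m H) G *m col_mx x w =
  (K *m (H *m x + w))^t* *m (K *m (H *m x + w)).
Proof.
rewrite /= quadratic_block adjM adjD adjM !(mulmxDl, mulmxDr) !mulmxA -!addrA.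
by congr (_ + _); rewrite addrCA.
Qed.

(** Cyclicity of the trace gathers the signal and noise contributions into the very matrix that
    [mmse] inverts, ready for cancellation by [mmseK]. *)
Lemma mean_vsq_output M N (Es N0 : R) (H : 'M[C]_(M, N)) (K : 'M[C]_(N, M))
    d (T : measurableType d) (P : probability T R)
    (X : {RV P >-> N.-tuple (Cspace R)}) (W : {RV P >-> M.-tuple (Cspace R)}) :
  0 < Es -> 0 < N0 -> is_CN Es X -> is_CN N0 W -> independent_RV2 X W ->
  has_mean P (fun w => vsq (K *m (H *m cvec (X w) + cvec (W w))))
    (Es * complex.Re (\tr (K^t* *m K *m (H *m H^t* + (N0 / Es)%:C%:M)))).
Proof.
move=> Es0 N00 hX hW XW.
pose G := K^t* *m K.
have := CN_mean_quadratic_form (block_mx (H^t* *m G *m H) (H^t* *m G) (G *m H) G)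
  Es0 N00 hX hW XW.
rewrite block_mxKul block_mxKdr.
have -> : Es * complex.Re (\tr (H^t* *m G *m H)) + N0 * complex.Re (\tr G) =
    Es * complex.Re (\tr (G *m (H *m H^t* + (N0 / Es)%:C%:M))).
  rewrite mulmxDr raddfD/= raddfD/= mulrDr; congr (_ * complex.Re _ + _).
    by rewrite -mulmxA mxtrace_mulC mulmxA.
  by rewrite mul_mx_scalar mxtraceZ complex_ReM/= mul0r subr0 mulrA mulrCA divff ?mulr1// gt_eqF.
move=> hm; congr has_mean: hm; apply/funext => w.
by rewrite output_quadratic_form vsqE.
Qed.

End MatrixAlgebra.

(** * Inverses of triangular matrices *)

Section Triangular.
Variable F : fieldType.

(** Forward substitution: row [i] of [S V = 1] expresses [S i i * V i j] through the earlier rows of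
    [V]. Induction on a bound for the row index kills the entries above the diagonal, and the
    diagonal equation becomes [S i i * V i i = 1]. *)
Lemma inv_trig_mx n (S V : 'M[F]_n) : is_trig_mx S -> (forall i, S i i != 0) ->
  S *m V = 1%:M -> is_trig_mx V /\ forall i, V i i = (S i i)^-1.
Proof.
move=> /is_trig_mxP trS S0 SV.
have row i j : S i i * V i j + \sum_(k < n | (k < i)%N) S i k * V k j = (i == j)%:R.
  have := congr1 (fun A : 'M[F]_n => A i j) SV; rewrite !mxE => <-.
  rewrite [RHS](bigD1 i)//=; congr (_ + _).
  rewrite [RHS](bigID (fun k : 'I_n => (k < i)%N))/= [X in _ = _ + X]big1 ?addr0.
    apply: eq_bigl => k; case: ltngtP; rewrite ?andbT ?andbF//.
    by move=> ki; apply/esym; rewrite -(inj_eq val_inj) neq_ltn ki.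
  move=> k /andP[ki]; rewrite -leqNgt leq_eqVlt => /orP[/eqP/val_inj ik|ik].
    by rewrite ik eqxx in ki.
  by rewrite trS// mul0r.
have V0 (m : nat) (i j : 'I_n) : (i < m)%N -> (i < j)%N -> V i j = 0.
  elim: m i => [//|m IH] i im ij.
  have := row i j; rewrite big1 ?addr0 => [|k ki]; last first.
    by rewrite (IH k (leq_trans ki im) (ltn_trans ki ij)) mulr0.
  have /negbTE-> : i != j by rewrite neq_ltn ij.
  by move/eqP; rewrite mulf_eq0 (negbTE (S0 i)) => /eqP.
have {}V0 (i j : 'I_n) : (i < j)%N -> V i j = 0 by exact: (V0 i.+1).
split; first exact/is_trig_mxP.
move=> i; have := row i i; rewrite eqxx big1 ?addr0 => [Hi|k ki].
  by rewrite -[LHS](mulKf (S0 i)) Hi mulr1.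
by rewrite V0 ?mulr0.
Qed.

Lemma trig_unitmx n (S : 'M[F]_n) :
  is_trig_mx S -> (forall i, S i i != 0) -> S \in unitmx.
Proof.
by move=> trS S0; rewrite unitmxE det_trig// unitfE; apply/prodf_neq0 => i _.
Qed.

End Triangular.

(** * The punctured factor: triangularity, row normalisation, determinant *)

Section PuncturedFactor.
Variable R : realType.
Local Notation C := R[i].

Lemma cnormSq (z : C) : z * z^* = (sqn z)%:C.
Proof.
case: z => a b; apply/eqP; rewrite eq_complex /sqn/=.
by apply/andP; split; apply/eqP; ring.
Qed.

Lemma gt0_complexE (z : C) : 0 < z -> z = (complex.Re z)%:C /\ 0 < complex.Re z.
Proof. by case: z => a b; rewrite ltcE/= => /andP[/eqP-> ?]. Qed.

Lemma sqrtC_real (r : R) : 0 <= r -> sqrtC (r%:C : C) = (Num.sqrt r)%:C.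
Proof.
by move=> r0; rewrite -{1}(sqr_sqrtr r0) rmorphXn/= sqrCK// ler0c sqrtr_ge0.
Qed.

Lemma enorm_sqr n (v : 'rV[C]_n) : enorm v ^+ 2 = \sum_j sqn (v 0 j).
Proof. by rewrite sqr_sqrtr//; apply: sumr_ge0 => j _; rewrite addr_ge0 ?sqr_ge0. Qed.

Lemma gram_diag m n (V : 'M[C]_(m, n)) k : (V *m V^t*) k k = (\sum_j sqn (V k j))%:C.
Proof.
by rewrite mxE rmorph_sum/=; apply: eq_bigr => j _; rewrite !mxE cnormSq.
Qed.
Section PuncturedBlock.
Variables (nu r : nat) (L : 'M[C]_(nu + r)).
Hypotheses (Ltrig : is_trig_mx L) (Lgt0 : forall i, 0 < L i i).
Let S := drsubmx L.
Let V := invmx S.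
(** The [k]-th diagonal entry of [S^-1 S^-t*]; the diagonal of [Omega] is its inverse square
    root. *)
Let rho k := \sum_j sqn (V k j).

Let Strig : is_trig_mx S. Proof. exact: drsubmx_trig. Qed.

Let Sgt0 k : 0 < S k k. Proof. by rewrite !mxE; exact: Lgt0. Qed.

Let S0 k : S k k != 0. Proof. by rewrite gt_eqF. Qed.

Let Sunit : S \in unitmx. Proof. exact: trig_unitmx. Qed.

(** Row [k] of the lower triangular [V] consists of the entries before the diagonal and the diagonal
    entry [1 / S k k], which contributes the [+ 1]. This is the argument of the logarithm in the
    gap. *)
Lemma rho_row_before k : complex.Re (S k k) ^+ 2 * rho k =
  complex.Re (S k k) ^+ 2 * enorm (row_before V k) ^+ 2 + 1.
Proof.
have [/is_trig_mxP Vtrig Vd] := inv_trig_mx Strig S0 (mulmxV Sunit).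
have [Sk Sk0] := gt0_complexE (Sgt0 k).
have rhoE : rho k = sqn (V k k) + enorm (row_before V k) ^+ 2.
  rewrite enorm_sqr /rho (bigD1 k)//=; congr (_ + _).
  under [RHS]eq_bigr do rewrite mxE.
  rewrite -(big_ord_narrow (F := fun j => sqn (V k j)) (ltnW (ltn_ord k))).
  rewrite [LHS](bigID (fun j : 'I_r => (j < k)%N))/= [X in _ + X]big1 ?addr0.
    apply: eq_bigl => j; case: ltngtP; rewrite ?andbT ?andbF// => jk.
    by rewrite -(inj_eq val_inj) neq_ltn jk.
  move=> j /andP[jk]; rewrite -leqNgt leq_eqVlt => /orP[/eqP/val_inj kj|kj].
    by rewrite kj eqxx in jk.
  by rewrite Vtrig// /sqn/= expr0n addr0.
rewrite rhoE mulrDr addrC; congr (_ + _).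
rewrite Vd Sk -rmorphV/=; last by rewrite unitfE gt_eqF.
by rewrite /sqn/= expr0n addr0 -exprMn divff ?expr1n// gt_eqF.
Qed.

Lemma rho_gt0 k : 0 < rho k.
Proof.
have [_ Sk0] := gt0_complexE (Sgt0 k).
rewrite -(pmulr_rgt0 _ (exprn_gt0 2 Sk0)) rho_row_before ltr_wpDl//.
by rewrite mulr_ge0 ?sqr_ge0.
Qed.

Lemma OmegaE : Omega S = diag_mx (\row_k ((Num.sqrt (rho k))^-1)%:C).
Proof.
congr diag_mx; apply/rowP => k.
rewrite [LHS]mxE [RHS]mxE gram_diag sqrtC_real ?(ltW (rho_gt0 k))//.
by rewrite fmorphV.
Qed.

Let Lp : 'M[C]_(nu + r) := block_mx (ulsubmx L) 0 (Omega S *m V *m dlsubmx L) (Omega S).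
(** The left factor taking [L] to [Lp]. Its rows are unit vectors, as [Omega] divides row [k] of [V]
    by its norm. *)
Let Q : 'M[C]_(nu + r) := block_mx 1%:M 0 0 (Omega S *m V).

Let Lp_ul i : Lp (lshift r i) (lshift r i) = L (lshift r i) (lshift r i).
Proof. by rewrite block_mxEul !mxE. Qed.

Let Lp_dr k : Lp (rshift nu k) (rshift nu k) = ((Num.sqrt (rho k))^-1)%:C.
Proof. by rewrite block_mxEdr OmegaE !mxE eqxx mulr1n. Qed.

Let Lp_trig : is_trig_mx Lp.
Proof.
rewrite is_trig_block_mx// eqxx ulsubmx_trig//=.
by rewrite diag_mx_is_trig.
Qed.

Let Lp_gt0 i : 0 < Lp i i.
Proof.
move: i => j; rewrite -[j]splitK; case: (fintype.split j) => k /=; first by rewrite Lp_ul.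
by rewrite Lp_dr ltcR invr_gt0 sqrtr_gt0 rho_gt0.
Qed.

Let LpE : Lp = Q *m L.
Proof.
rewrite -[in RHS](submxK L) ursubmx_trig// mulmx_block !mul0mx !mulmx0 !mul1mx !addr0 add0r.
by rewrite -(mulmxA (Omega S) V S) mulVmx// mulmx1 add0r.
Qed.

Let trQ : \tr (Q *m Q^t*) = (nu + r)%:R.
Proof.
rewrite /Q tr_block_mx map_block_mx !trmx0 trmx1 !map_mx0 map_mx1.
rewrite mulmx_block !mul0mx !mulmx0 !mul1mx !addr0 add0r.
rewrite mxtrace_block mxtrace1 natrD; congr (_ + _).
transitivity (\sum_(k < r) 1 : C); last by rewrite sumr_const card_ord.
apply: eq_bigr => k _; rewrite gram_diag.
rewrite OmegaE; under eq_bigr do rewrite mul_diag_mx !mxE.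
have -> : \sum_i sqn (((Num.sqrt (rho k))^-1)%:C * V k i) = (rho k)^-1 * rho k.
  rewrite mulr_sumr; apply: eq_bigr => j _.
  have -> : (rho k)^-1 = (Num.sqrt (rho k))^-1 ^+ 2.
    by rewrite exprVn sqr_sqrtr// ltW ?rho_gt0.
  by case: (V k j) => x y; rewrite /sqn/=; ring.
by rewrite mulVf// gt_eqF ?rho_gt0.
Qed.

(** The diagonals of [L] and [Lp] agree on the first block; on the second, [Lp] has squares
    [1 / rho k], so the quotient is [S k k ^ 2 * rho k]. *)
Let prodE : \prod_i complex.Re (L i i) ^+ 2 = \prod_i complex.Re (Lp i i) ^+ 2 *
  \prod_k (complex.Re (S k k) ^+ 2 * enorm (row_before V k) ^+ 2 + 1).
Proof.
rewrite !big_split_ord/= -mulrA -big_split/=; congr (_ * _).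
  by apply: eq_bigr => i _; rewrite Lp_ul.
apply: eq_bigr => k _; rewrite Lp_dr -rho_row_before/= !mxE.
rewrite exprVn sqr_sqrtr ?(ltW (rho_gt0 k))// mulrCA mulVf ?mulr1//.
by rewrite gt_eqF ?rho_gt0.
Qed.

Lemma punctured_block_facts :
  [/\ is_trig_mx Lp, forall i, 0 < Lp i i,
      exists2 Q : 'M[C]_(nu + r), Lp = Q *m L & \tr (Q *m Q^t*) = (nu + r)%:R &
      \prod_i complex.Re (L i i) ^+ 2 = \prod_i complex.Re (Lp i i) ^+ 2 *
        \prod_k (complex.Re (S k k) ^+ 2 * enorm (row_before V k) ^+ 2 + 1)].
Proof.
by split=> //; exists Q.
Qed.

End PuncturedBlock.

Lemma punctured_factor_facts N nu (h : (nu <= N)%N) (L : 'M[C]_N) :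
  is_trig_mx L -> (forall i, 0 < L i i) ->
  [/\ is_trig_mx (Lpunct h L), forall i, 0 < Lpunct h L i i,
      exists2 Q : 'M[C]_N, Lpunct h L = Q *m L & \tr (Q *m Q^t*) = N%:R &
      \prod_i complex.Re (L i i) ^+ 2 = \prod_i complex.Re (Lpunct h L i i) ^+ 2 *
        \prod_k (complex.Re (Sblock h L k k) ^+ 2 *
                 enorm (row_before (invmx (Sblock h L)) k) ^+ 2 + 1)].
Proof.
rewrite /Lpunct /Sblock /Pblock /Rblock /partition_at.
(* Generalising [N - nu] and substituting [N := nu + r] turns every cast into the identity. *)
move: (N - nu)%N (subnKC h) => r e; clear h; subst N.
rewrite /= !castmx_id; exact: punctured_block_facts.
Qed.

End PuncturedFactor.

(** * Capacity, rate of the punctured factor, and their difference *)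

Section CapacityGap.
Variable R : realType.
Local Notation C := R[i].

Lemma sqn_ge0 (z : C) : 0 <= sqn z.
Proof. by rewrite addr_ge0 ?sqr_ge0. Qed.

Lemma sqn_eq0 (z : C) : sqn z = 0 -> z = 0.
Proof.
case: z => a b /eqP; rewrite /sqn/= paddr_eq0 ?sqr_ge0// !sqrf_eq0.
by move=> /andP[/eqP-> /eqP->].
Qed.

(** A row [v] in the left kernel satisfies [|v A|^2 + c |v|^2 = 0], hence vanishes. *)
Lemma regularized_gram_unitmx m n (A : 'M[C]_(m, n)) (c : R) : 0 < c ->
  A *m A^t* + c%:C%:M \in unitmx.
Proof.
move=> c0; rewrite -row_free_unit -kermx_eq0; apply/rowV0P => v /sub_kermxP vD.
have E : (v *m A) *m (v *m A)^t* + c%:C *: (v *m v^t*) = 0.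
  transitivity (v *m (A *m A^t* + c%:C%:M) *m v^t*); last by rewrite vD mul0mx.
  by rewrite mulmxDr mulmxDl mul_mx_scalar -scalemxAl adjM !mulmxA.
have := congr1 (fun B : 'M[C]_1 => B 0 0) E.
rewrite [LHS]mxE [X in _ + X]mxE [RHS]mxE !gram_diag -rmorphM -rmorphD/= => /eqP.
rewrite -(rmorph0 (real_complex R)) (inj_eq (fmorph_inj _)) paddr_eq0; last 2 first.
- by apply: sumr_ge0 => j _; exact: sqn_ge0.
- by rewrite mulr_ge0 ?(ltW c0)//; apply: sumr_ge0 => j _; exact: sqn_ge0.
move=> /andP[_]; rewrite mulf_eq0 (gt_eqF c0)/= psumr_eq0; last first.
  by move=> j _; exact: sqn_ge0.
move=> /allP v0; apply/rowP => j; rewrite mxE; apply: sqn_eq0; apply/eqP.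
exact: v0 (mem_index_enum j).
Qed.

Lemma adjZ m n (a : R) (A : 'M[C]_(m, n)) : (a%:C *: A)^t* = a%:C *: A^t*.
Proof.
apply/matrixP => i j; rewrite !mxE rmorphM/=; congr (_ * _).
by apply/eqP; rewrite eq_complex/= oppr0 !eqxx.
Qed.

Lemma Haug_gram M N (Es N0 : R) (H : 'M[C]_(M, N)) : 0 < Es -> 0 < N0 ->
  (Haug Es N0 H)^t* *m Haug Es N0 H =
  (N0^-1)%:C *: (H^t* *m H + (N0 / Es)%:C%:M).
Proof.
move=> Es0 N00; rewrite /Haug tr_col_mx map_row_mx mul_row_col !adjZ.
rewrite -!scalemxAl -!scalemxAr !scalerA -!rmorphM/= -!expr2 !exprVn !sqr_sqrtr ?ltW//.
rewrite trmx1 map_mx1 mul1mx scalerDr; congr (_ + _).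
by rewrite !scale_scalar_mx mulr1 -rmorphM/= mulrA mulVf ?mul1r ?gt_eqF.
Qed.

Lemma mmseK M N (Es N0 : R) (H : 'M[C]_(M, N)) : 0 < Es -> 0 < N0 ->
  mmse Es N0 H *m (H *m H^t* + (N0 / Es)%:C%:M) = H^t*.
Proof. by move=> Es0 N00; rewrite mulmxKV// regularized_gram_unitmx// divr_gt0. Qed.

(** The push-through identity [H^t* (H H^t* + c) = (H^t* H + c) H^t*] and its mirror are behind
    this: [Es (1 - mmse H)], the MMSE error covariance, is the inverse of the augmented Gram
    matrix. *)
Lemma mmse_residual M N (Es N0 : R) (H : 'M[C]_(M, N)) : 0 < Es -> 0 < N0 ->
  (1%:M - mmse Es N0 H *m H) *m ((Haug Es N0 H)^t* *m Haug Es N0 H) =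
  (Es^-1)%:C%:M.
Proof.
move=> Es0 N00; rewrite Haug_gram// -scalemxAr mulmxBl mul1mx.
have -> : mmse Es N0 H *m H *m (H^t* *m H + (N0 / Es)%:C%:M) = H^t* *m H.
  rewrite -[in RHS](mmseK H Es0 N00) -[RHS]mulmxA -[LHS]mulmxA; congr (_ *m _).
  by rewrite mulmxDr mulmxDl mulmxA mul_mx_scalar mul_scalar_mx.
rewrite addrAC subrr add0r scale_scalar_mx -rmorphM/= mulrA mulVf ?mul1r//.
by rewrite gt_eqF.
Qed.

(** By [mmse_residual], conjugating the residual [B] by [La] gives the scalar [1 / Es]; cyclicity
    then leaves only the trace of [Q^t* Q]. *)
Lemma trace_identity M N (Es N0 : R) (H : 'M[C]_(M, N)) (Qa : 'M[C]_(M + N, N))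
    (La Q : 'M[C]_N) : 0 < Es -> 0 < N0 ->
  is_thin_QL (Haug Es N0 H) Qa La -> \tr (Q *m Q^t*) = N%:R ->
  \tr ((1%:M - H^t* *m (mmse Es N0 H)^t*) *m Gap (Q *m La)) = (Es^-1)%:C * N%:R.
Proof.
move=> Es0 N00 [HE QQ Ltrig Lgt0] trQ.
have Lu : La \in unitmx by apply: trig_unitmx => // i; rewrite gt_eqF.
set B := 1%:M - mmse Es N0 H *m H.
have BL : B *m (La^t* *m La) = (Es^-1)%:C%:M.
  rewrite -(mmse_residual H Es0 N00) -/B; congr (_ *m _).
  by rewrite HE adjM mulmxA -(mulmxA (La^t*)) QQ mulmx1.
have BE : La *m B *m La^t* = (Es^-1)%:C%:M.
  (* Right multiplication by the invertible [La] is injective and reduces the claim to [BL]. *)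
  apply: (can_inj (mulmxK Lu)).
  by rewrite -!mulmxA BL mul_mx_scalar mul_scalar_mx.
have BE' : La *m B^t* *m La^t* = (Es^-1)%:C%:M.
  have := congr1 (fun A : 'M[C]_N => A^t*) BE.
  rewrite !adjM adjK mulmxA => ->; apply/matrixP => i j; rewrite !mxE eq_sym.
  by case: eqP => _; apply/eqP; rewrite ?mulr1n ?mulr0n eq_complex/= oppr0 !eqxx.
have -> : 1%:M - H^t* *m (mmse Es N0 H)^t* = B^t*.
  by rewrite adjD adjN (adjM (mmse Es N0 H)) trmx1 map_mx1.
rewrite /Gap adjM.
transitivity (\tr (La *m B^t* *m La^t* *m (Q^t* *m Q))).
  by rewrite !mulmxA mxtrace_mulC !mulmxA.
by rewrite BE' mul_scalar_mx mxtraceZ mxtrace_mulC trQ.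
Qed.

(** The matrix is [Es] times the augmented Gram matrix, that is [Es La^t* La], with [La] triangular
    of real diagonal. *)
Lemma Re_det_capacity M N (Es N0 : R) (H : 'M[C]_(M, N)) (Qa : 'M[C]_(M + N, N))
    (La : 'M[C]_N) : 0 < Es -> 0 < N0 -> is_thin_QL (Haug Es N0 H) Qa La ->
  complex.Re (\det ((Es / N0)%:C *: (H^t* *m H) + 1%:M)) =
  Es ^+ N * \prod_i complex.Re (La i i) ^+ 2.
Proof.
move=> Es0 N00 [HE QQ Ltrig Lgt0].
have -> : (Es / N0)%:C *: (H^t* *m H) + 1%:M = Es%:C *: (La^t* *m La).
  have -> : La^t* *m La = (Haug Es N0 H)^t* *m Haug Es N0 H.
    by rewrite HE adjM mulmxA -(mulmxA (La^t*)) QQ mulmx1.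
  rewrite Haug_gram// scalerA -rmorphM/= scalerDr; congr (_ + _).
  rewrite scale_scalar_mx -rmorphM/= mulrACA -invfM [N0 * _]mulrC divff ?rmorph1//.
  by rewrite mulf_neq0// gt_eqF.
rewrite detZ det_mulmx det_map_mx det_tr det_trig// -rmorphXn/=.
under eq_bigr => i _ do rewrite (gt0_complexE (Lgt0 i)).1.
rewrite -rmorph_prod/= prodrXl.
by move: (\prod_i _) => p; ring.
Qed.

Lemma ln_prod (I : finType) (f : I -> R) :
  (forall i, 0 < f i) -> ln (\prod_i f i) = \sum_i ln (f i).
Proof.
move=> f0; apply: expR_inj; rewrite lnK ?posrE ?prodr_gt0// expR_sum.
by apply: eq_bigr => i _; rewrite lnK// posrE.
Qed.

Lemma I_LB_punctured M N (Es N0 : R) (H : 'M[C]_(M, N)) (Qa : 'M[C]_(M + N, N))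
    (La Q : 'M[C]_N) d (T : measurableType d) (P : probability T R)
    (X : {RV P >-> N.-tuple (Cspace R)}) (W : {RV P >-> M.-tuple (Cspace R)}) :
  0 < Es -> 0 < N0 -> is_thin_QL (Haug Es N0 H) Qa La ->
  is_CN Es X -> is_CN N0 W -> independent_RV2 X W ->
  \tr (Q *m Q^t*) = N%:R ->
  is_trig_mx (Q *m La) -> (forall i, 0 < (Q *m La) i i) ->
  I_LB Es N0 H (Q *m La) X W =
  (ln (Es ^+ N * \prod_i complex.Re ((Q *m La) i i) ^+ 2))%:E.
Proof.
move=> Es0 N00 hQL hX hW XW trQ trig gt0; set L := Q *m La.
have [_ E1] := mean_ln_p_cond H L Es0 N00 hX hW XW.
have h2 := mean_vsq_output H (L *m mmse Es N0 H) Es0 N00 hX hW XW.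
set D := Es ^+ N * _.
have D0 : 0 < D.
  rewrite mulr_gt0 ?exprn_gt0// prodr_gt0// => i _.
  by rewrite exprn_gt0// (gt0_complexE (gt0 i)).2.
have [_ E2] := has_meanD h2 (has_mean_cst P (- ln D)).
rewrite /I_LB unlock E1.
under eq_integral => w _.
  rewrite p_outE// lne_EFin ?divr_gt0 ?expR_gt0// ln_div ?posrE ?expR_gt0// expRK mulmxA.
  over.
rewrite E2 -EFinB; congr EFin.
(* [mmseK] cancels the output covariance, so the mean of the squared norm has the same trace as the
   cross term of the metric. *)
have -> : \tr ((L *m mmse Es N0 H)^t* *m (L *m mmse Es N0 H) *m
    (H *m H^t* + ((N0 / Es)%:C)%:M)) = \tr (H^t* *m Fap Es N0 H L).
  have := mmseK H Es0 N00; rewrite /Fap /Gap.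
  move: (mmse Es N0 H) (H *m H^t* + _) => K A KA.
  by rewrite adjM -!mulmxA KA [RHS]mxtrace_mulC !mulmxA.
have := trace_identity Es0 N00 hQL trQ; rewrite mulmxBl mul1mx raddfB/= -mulmxA.
rewrite -/L -[(mmse Es N0 H)^t* *m Gap L]/(Fap Es N0 H L).
rewrite raddfD raddfB raddfMn/= mxtrace_scalar.
(* The rate is now [Es Re (f - g) + N + ln D], and the trace identity says [g - f = N / Es]. *)
move: (\tr (Gap L)) (\tr _) => g f.
move=> /(congr1 (@complex.Re R)).
rewrite complex_ReM !raddfD !raddfN !raddfMn/= mul0r subr0 -[Es^-1 *+ N]mulr_natr.
move: (complex.Re f) (complex.Re _) => a b /eqP; rewrite subr_eq => /eqP->.
by ring.
Qed.

End CapacityGap.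

Theorem corollary2 (R : realType) (M N nu : nat) (H : 'M[R[i]]_(M, N))
  (Es N0 : R) (hMN : (N <= M)%N) (hEs : 0 < Es) (hN0 : 0 < N0)
  (hnu1 : (1 <= nu)%N) (hnuN : (nu < N)%N)
  (Qa : 'M[R[i]]_(M + N, N)) (La : 'M[R[i]]_N)
  (hQL : is_thin_QL (Haug Es N0 H) Qa La)
  (d : measure_display) (T : measurableType d) (P : probability T R)
  (X : {RV P >-> N.-tuple (Cspace R)}) (W : {RV P >-> M.-tuple (Cspace R)})
  (hX : is_CN Es X) (hW : is_CN N0 W) (hXW : independent_RV2 X W) :
  let Sa := Sblock (ltnW hnuN) La in
  let Lap := Lpunct (ltnW hnuN) La in
  ((C_AWGN Es N0 H)%:E - I_LB Es N0 H Lap X W =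
   (\sum_(k < N - nu)
      ln (complex.Re (Sa k k) ^+ 2 * enorm (row_before (invmx Sa) k) ^+ 2 + 1))%R%:E)%E.
Proof.
move=> Sa Lap.
have [_ _ Ltrig Lgt0] := hQL.
have [Ltrig' Lgt0' [Q LE trQ] prodE] := punctured_factor_facts (ltnW hnuN) Ltrig Lgt0.
rewrite -/Lap -/Sa in Ltrig' Lgt0' LE prodE.
have -> : I_LB Es N0 H Lap X W = (ln (Es ^+ N * \prod_i complex.Re (Lap i i) ^+ 2))%:E.
  rewrite LE in Ltrig' Lgt0' *; exact: (I_LB_punctured hEs hN0 hQL hX hW hXW trQ).
(* The capacity determinant factors as the one in the rate times the product of the gap terms, so
   subtracting logarithms leaves the sum. *)
rewrite /C_AWGN (Re_det_capacity hEs hN0 hQL) prodE mulrA.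
have f0 k : 0 < complex.Re (Sa k k) ^+ 2 * enorm (row_before (invmx Sa) k) ^+ 2 + 1.
  by rewrite ltr_wpDl// mulr_ge0 ?sqr_ge0.
rewrite lnM ?posrE; last 2 first.
- rewrite mulr_gt0 ?exprn_gt0// prodr_gt0// => i _.
  by rewrite exprn_gt0// (gt0_complexE (Lgt0' i)).2.
- by rewrite prodr_gt0.
by rewrite -EFinB addrAC subrr add0r ln_prod.
Qed.
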